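(* Let $Q$ be a finite quiver with vertices $1,\dots,n$ and no oriented cycles, $k=\mathbb{F}_q$, let $\tilde Q$ be an extended quiver of $Q$ with frozen vertices $n+1,\dots,m$, and let $\Lambda$ be an $m\times m$ antisymmetric matrix unitally compatible with $\tilde B$. Let $U,V$ be finite-dimensional representations of $Q$ over $k$ of dimension vectors $\alpha_1,\alpha_2$. Then in $\mathcal{P}_\lambda$ $$X(U)X(V)=\lambda(\tilde g(\alpha_1),\tilde g(\alpha_2))^{-\frac12}\sum_{[W]}\frac{|\mathrm{Ext}_Q(U,V)_W|}{|\mathrm{Ext}_Q(U,V)|}X(W),$$ the sum being over isomorphism classes $[W]$ of representations of $Q$.
   Context: Vectors are row vectors. The Euler matrix $E$ of $Q$ has entries $E_{ij}=\delta_{ij}-|\text{arrows } i\to j|$, so the additive Euler form is $\langle\alpha,\beta\rangle_a=\alpha E\beta^T$; put $\langle\alpha,\beta\rangle:=q^{\langle\alpha,\beta\rangle_a}$. An extended quiver $\tilde Q$ is obtained from $Q$ by adding frozen vertices $n+1,\dots,m$ so that there is no arrow from a vertex of $Q$ to a frozen vertex. $\tilde E$ is the $m\times n$ matrix formed by the first $n$ columns of the Euler matrix of $\tilde Q$. $\tilde B$ is the $n\times m$ matrix with entries $b_{i,j}=|\text{arrows } j\to i|-|\text{arrows } i\to j|$ (in $\tilde Q$). An $m\times m$ antisymmetric matrix $\Lambda$ is unitally compatible with $\tilde B$ if $-\tilde B\Lambda=(I_n,0)$. Put $\tilde g(\alpha)=-\alpha\tilde E^T$ and $\tilde\phi(\gamma)=\gamma\tilde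 B$ (both in $\mathbb{Z}^m$). $\lambda(a,b):=q^{a\Lambda b^T}$ is the multiplicative antisymmetric form of $\Lambda$. $\mathcal{P}_\lambda$ is the quantum Laurent polynomial algebra with basis $x^a$, $a\in\mathbb{Z}^m$, and multiplication $x^ax^b=\lambda(a,b)^{-\frac12}x^{a+b}$ (over $\mathbb{C}$, with a fixed square root $q^{1/2}$). For a finite-dimensional representation $M$ of $Q$ of dimension vector $\alpha$, $$X(M)=\sum_\gamma\langle\gamma,\alpha-\gamma\rangle^{-\frac12}|\mathrm{Gr}_\gamma(M)|\,x^{\tilde g(\alpha)-\tilde\phi(\gamma)},$$ where $\mathrm{Gr}_\gamma(M)$ is the set of subrepresentations of $M$ of dimension vector $\gamma$. $\mathrm{Ext}_Q=\mathrm{Ext}^1$, and $\mathrm{Ext}_Q(U,V)_W$ is the set of classes of extensions $0\to V\to E'\to U\to0$ with $E'\cong W$. *)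

(* Defs.v *)
From HB Require Import structures.
From mathcomp Require Import all_boot all_order all_algebra.
From mathcomp Require Import finmap monalg complex.
From mathcomp Require Import boolp classical_sets functions cardinality fsbigop.
From mathcomp Require Import reals.

Set Implicit Arguments.
Unset Strict Implicit.
Unset Printing Implicit Defensive.

Import GRing.Theory Num.Theory.
Local Open Scope classical_set_scope.
Local Open Scope ring_scope.
Local Open Scope quotient_scope.

(* Only meaningful for finite sets: fset_set of an infinite set is empty. *)
Definition ncard (T : choiceType) (A : set T) : nat := #|` fset_set A|%fset.

(* The value a A b^T of the bilinear form with matrix A at row vectors a, b. *)
Definition bform (p : nat) (A : 'M[int]_p) (a b : 'rV[int]_p) : int :=
  (a *m A *m b^T) 0 0.

Record quiver (n : nat) := Quiver {
  arrow : finType;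
  src : arrow -> 'I_n;
  tgt : arrow -> 'I_n }.

Definition narrows (n : nat) (Q : quiver n) (i j : 'I_n) : nat :=
  #|[pred a : arrow Q | (src a == i) && (tgt a == j)]|.

Definition acyclic (n : nat) (Q : quiver n) : Prop :=
  forall c : seq 'I_n, cycle (fun i j => 0 < narrows Q i j)%N c -> c = [::].

Definition euler (n : nat) (Q : quiver n) : 'M[int]_n :=
  \matrix_(i, j) ((i == j)%:Z - (narrows Q i j)%:Z).

(* The vertices of Q are the vertices lshift r i of the larger quiver, and the
   frozen vertices are the rshift n j.  Arrows between two frozen vertices, or
   from a frozen vertex to a vertex of Q, are unrestricted. *)
Definition extended_quiver (n r : nat) (Q : quiver n) (Qt : quiver (n + r)) :
    Prop :=
  (exists iota : arrow Q -> arrow Qt,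
    [/\ injective iota,
        forall a, src (iota a) = lshift r (src a),
        forall a, tgt (iota a) = lshift r (tgt a)
      & forall b i j, src b = lshift r i -> tgt b = lshift r j ->
          exists a, b = iota a]) /\
  (forall (b : arrow Qt) i j, src b = lshift r i -> tgt b <> rshift n j).

Definition euler_ext (n r : nat) (Qt : quiver (n + r)) : 'M[int]_(n + r, n) :=
  lsubmx (euler Qt).

Definition bmx_ext (n r : nat) (Qt : quiver (n + r)) : 'M[int]_(n, n + r) :=
  \matrix_(i, j) ((narrows Qt j (lshift r i))%:Z
                  - (narrows Qt (lshift r i) j)%:Z).

Definition unitally_compatible (n r : nat) (Qt : quiver (n + r))
    (L : 'M[int]_(n + r)) : Prop :=
  - (bmx_ext Qt *m L) = row_mx 1%:M 0.

Definition gvec (n r : nat) (Qt : quiver (n + r)) (a : 'rV[int]_n) :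
    'rV[int]_(n + r) :=
  - (a *m (euler_ext Qt)^T).

Definition phivec (n r : nat) (Qt : quiver (n + r)) (c : 'rV[int]_n) :
    'rV[int]_(n + r) :=
  c *m bmx_ext Qt.

(* As in the representation theory of MathComp, representations are matrix
   representations: the space at the vertex i is 'rV[F]_(d i), and an arrow
   i -> j acts by v |-> v *m A with A : 'M[F]_(d i, d j). *)
Definition rep (n : nat) (Q : quiver n) (F : finFieldType) : Type :=
  {d : {ffun 'I_n -> nat} &
     {dffun forall a : arrow Q, 'M[F]_(d (src a), d (tgt a))}}.
HB.instance Definition _ (n : nat) (Q : quiver n) (F : finFieldType) :=
  Choice.on (rep Q F).

Definition rdim (n : nat) (Q : quiver n) (F : finFieldType)
    (M : rep Q F) : {ffun 'I_n -> nat} := tag M.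

Definition ract (n : nat) (Q : quiver n) (F : finFieldType)
    (M : rep Q F) (a : arrow Q) :
    'M[F]_(rdim M (src a), rdim M (tgt a)) := tagged M a.

Definition dimvec (n : nat) (d : {ffun 'I_n -> nat}) : 'rV[int]_n :=
  \row_i (d i)%:Z.

Definition mxfamily (n : nat) (Q : quiver n) (F : finFieldType)
    (M N : rep Q F) : Type :=
  {dffun forall i : 'I_n, 'M[F]_(rdim M i, rdim N i)}.
HB.instance Definition _ (n : nat) (Q : quiver n) (F : finFieldType)
    (M N : rep Q F) :=
  Finite.on (mxfamily M N).

Definition is_hom (n : nat) (Q : quiver n) (F : finFieldType)
    (M N : rep Q F) (f : mxfamily M N) : bool :=
  [forall a, f (src a) *m ract N a == ract M a *m f (tgt a)].

Definition is_mono (n : nat) (Q : quiver n) (F : finFieldType)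
    (M N : rep Q F) (f : mxfamily M N) : bool :=
  is_hom f && [forall i, row_free (f i)].

Definition is_epi (n : nat) (Q : quiver n) (F : finFieldType)
    (M N : rep Q F) (f : mxfamily M N) : bool :=
  is_hom f && [forall i, row_full (f i)].

Definition is_iso (n : nat) (Q : quiver n) (F : finFieldType)
    (M N : rep Q F) (f : mxfamily M N) : bool :=
  is_mono f && is_epi f.

Definition isomorphic (n : nat) (Q : quiver n) (F : finFieldType)
    (M N : rep Q F) : bool :=
  [exists f : mxfamily M N, is_iso f].

Definition family_mul (n : nat) (Q : quiver n) (F : finFieldType)
    (M N P : rep Q F) (f : mxfamily M N) (g : mxfamily N P) : mxfamily M P :=
  [ffun i => f i *m g i].

Lemma family_mulE (n : nat) (Q : quiver n) (F : finFieldType)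
    (M N P : rep Q F) (f : mxfamily M N) (g : mxfamily N P) i :
  family_mul f g i = f i *m g i.
Proof. exact: ffunE. Qed.

Definition family_id (n : nat) (Q : quiver n) (F : finFieldType)
    (M : rep Q F) : mxfamily M M := [ffun i => 1%:M].

Definition family_inv (n : nat) (Q : quiver n) (F : finFieldType)
    (M N : rep Q F) (f : mxfamily M N) : mxfamily N M :=
  [ffun i => pinvmx (f i)].

Lemma is_isoP (n : nat) (Q : quiver n) (F : finFieldType) (M N : rep Q F)
    (f : mxfamily M N) :
  reflect [/\ forall a, f (src a) *m ract N a = ract M a *m f (tgt a),
              forall i, row_free (f i) & forall i, row_full (f i)]
          (is_iso f).
Proof.
rewrite /is_iso /is_mono /is_epi.
apply: (iffP andP) => [[/andP[h m] /andP[_ e]]|[h m e]].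
  split=> [a|i|i]; last exact: (forallP e).
    by apply/eqP; exact: (forallP h).
  exact: (forallP m).
have hf : is_hom f by apply/forallP => a; apply/eqP; exact: h.
by split; apply/andP; split=> //; apply/forallP => i; [exact: m | exact: e].
Qed.

Lemma family_idP (n : nat) (Q : quiver n) (F : finFieldType) (M : rep Q F) :
  is_iso (family_id M).
Proof.
apply/is_isoP; split=> [a|i|i]; rewrite !ffunE ?mulmx1 ?mul1mx //.
  by rewrite row_free_unit unitmx1.
by rewrite row_full_unit unitmx1.
Qed.

Lemma family_mulP (n : nat) (Q : quiver n) (F : finFieldType)
    (M N P : rep Q F) (f : mxfamily M N) (g : mxfamily N P) :
  is_iso f -> is_iso g -> is_iso (family_mul f g).
Proof.
move=> /is_isoP[hf mf ef] /is_isoP[hg mg eg].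
apply/is_isoP; split=> [a|i|i]; rewrite !ffunE.
- by rewrite -mulmxA hg mulmxA hf mulmxA.
- by rewrite /row_free mxrankMfree //; exact: mf.
- apply/row_fullP; have /row_fullP[f' f'f] := ef i.
  have /row_fullP[g' g'g] := eg i.
  by exists (g' *m f'); rewrite mulmxA -(mulmxA g') f'f mulmx1.
Qed.

Lemma family_mulV (n : nat) (Q : quiver n) (F : finFieldType)
    (M N : rep Q F) (f : mxfamily M N) :
  is_iso f -> forall i, f i *m family_inv f i = 1%:M.
Proof. by move=> /is_isoP[_ mf _] i; rewrite ffunE mulmxVp. Qed.

Lemma family_mulVl (n : nat) (Q : quiver n) (F : finFieldType)
    (M N : rep Q F) (f : mxfamily M N) :
  is_iso f -> forall i, family_inv f i *m f i = 1%:M.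
Proof. by move=> /is_isoP[_ _ ef] i; rewrite ffunE mulVpmx. Qed.

Lemma family_invP (n : nat) (Q : quiver n) (F : finFieldType)
    (M N : rep Q F) (f : mxfamily M N) :
  is_iso f -> is_iso (family_inv f).
Proof.
move=> isof; have fV := family_mulV isof; have Vf := family_mulVl isof.
have /is_isoP[hf _ _] := isof.
apply/is_isoP; split=> [a|i|i].
- rewrite -[RHS]mul1mx -(Vf (src a)) -!mulmxA; congr (_ *m _).
  by rewrite [_ *m (ract N a *m _)]mulmxA hf -mulmxA fV mulmx1.
- by apply/row_freeP; exists (f i).
- by apply/row_fullP; exists (f i).
Qed.

Lemma isomorphic_refl (n : nat) (Q : quiver n) (F : finFieldType) :
  reflexive (@isomorphic n Q F).
Proof. by move=> M; apply/existsP; exists (family_id M); apply: family_idP. Qed.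

Lemma isomorphic_sym (n : nat) (Q : quiver n) (F : finFieldType) :
  symmetric (@isomorphic n Q F).
Proof.
move=> M N; apply/idP/idP => /existsP[f isof]; apply/existsP;
  by exists (family_inv f); apply: family_invP.
Qed.

Lemma isomorphic_trans (n : nat) (Q : quiver n) (F : finFieldType) :
  transitive (@isomorphic n Q F).
Proof.
move=> N M P /existsP[f isof] /existsP[g isog]; apply/existsP.
by exists (family_mul f g); apply: family_mulP.
Qed.

Canonical isomorphic_equiv (n : nat) (Q : quiver n) (F : finFieldType) :=
  EquivRel (@isomorphic n Q F) (@isomorphic_refl n Q F) (@isomorphic_sym n Q F)
    (@isomorphic_trans n Q F).

Definition isoclass (n : nat) (Q : quiver n) (F : finFieldType) : Type :=
  {eq_quot isomorphic_equiv Q F}.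
HB.instance Definition _ (n : nat) (Q : quiver n) (F : finFieldType) :=
  Choice.on (isoclass Q F).
HB.instance Definition _ (n : nat) (Q : quiver n) (F : finFieldType) :=
  Quotient.on (isoclass Q F).

Definition grassmannian (n : nat) (Q : quiver n) (F : finFieldType)
    (c : {ffun 'I_n -> nat}) (M : rep Q F) :
    set {dffun forall i : 'I_n, {vspace 'rV[F]_(rdim M i)}} :=
  [set N | (forall i, \dim (N i) = c i) /\
           (forall a (v : 'rV[F]_(rdim M (src a))),
              v \in N (src a) -> v *m ract M a \in N (tgt a))].
Arguments grassmannian {n Q F} c M.

(* Extensions 0 -> V -> E -> U -> 0, as in Ext^1(U, V). *)
Definition preextension (n : nat) (Q : quiver n) (F : finFieldType)
    (U V : rep Q F) : Type :=
  {E : rep Q F & (mxfamily V E * mxfamily E U)%type}.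
HB.instance Definition _ (n : nat) (Q : quiver n) (F : finFieldType)
    (U V : rep Q F) := Choice.on (preextension U V).

Definition is_extension (n : nat) (Q : quiver n) (F : finFieldType)
    (U V : rep Q F) (x : preextension U V) : bool :=
  let: existT _ (f, g) := x in
  [&& is_mono f, is_epi g & [forall i, (f i == kermx (g i))%MS]].

Definition extension (n : nat) (Q : quiver n) (F : finFieldType)
    (U V : rep Q F) : Type := {x : preextension U V | is_extension x}.
HB.instance Definition _ (n : nat) (Q : quiver n) (F : finFieldType)
    (U V : rep Q F) := Choice.on (extension U V).

Definition ext_middle (n : nat) (Q : quiver n) (F : finFieldType)
    (U V : rep Q F) (x : extension U V) : rep Q F := tag (val x).

Definition ext_incl (n : nat) (Q : quiver n) (F : finFieldType) (U V : rep Q F)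
    (x : extension U V) : mxfamily V (ext_middle x) := (tagged (val x)).1.

Definition ext_proj (n : nat) (Q : quiver n) (F : finFieldType) (U V : rep Q F)
    (x : extension U V) : mxfamily (ext_middle x) U := (tagged (val x)).2.

Definition ext_equiv (n : nat) (Q : quiver n) (F : finFieldType)
    (U V : rep Q F) (x y : extension U V) : bool :=
  [exists h : mxfamily (ext_middle x) (ext_middle y),
    [&& is_iso h, family_mul (ext_incl x) h == ext_incl y
      & family_mul h (ext_proj y) == ext_proj x]].

Lemma ext_equiv_refl (n : nat) (Q : quiver n) (F : finFieldType)
    (U V : rep Q F) : reflexive (@ext_equiv n Q F U V).
Proof.
move=> x; apply/existsP; exists (family_id (ext_middle x)).
rewrite family_idP /=; apply/andP; split; apply/eqP/ffunP => i;
  by rewrite !ffunE ?mulmx1 ?mul1mx.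
Qed.

Lemma ext_equiv_sym (n : nat) (Q : quiver n) (F : finFieldType)
    (U V : rep Q F) : symmetric (@ext_equiv n Q F U V).
Proof.
suff sym x y : @ext_equiv n Q F U V x y -> ext_equiv y x.
  by move=> x y; apply/idP/idP; apply: sym.
move=> /existsP[h /and3P[isoh /eqP hi /eqP hp]]; apply/existsP.
exists (family_inv h); rewrite family_invP //= -hi -hp.
apply/andP; split; apply/eqP/ffunP => i; rewrite !family_mulE.
  by rewrite -mulmxA family_mulV // mulmx1.
by rewrite mulmxA family_mulVl // mul1mx.
Qed.

Lemma ext_equiv_trans (n : nat) (Q : quiver n) (F : finFieldType)
    (U V : rep Q F) : transitive (@ext_equiv n Q F U V).
Proof.
move=> y x z /existsP[h /and3P[isoh /eqP hi /eqP hp]].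
move=> /existsP[k /and3P[isok /eqP ki /eqP kp]]; apply/existsP.
exists (family_mul h k); rewrite family_mulP //= -ki -hi -hp -kp.
by apply/andP; split; apply/eqP/ffunP => i; rewrite !ffunE !mulmxA.
Qed.

Canonical ext_equiv_equiv (n : nat) (Q : quiver n) (F : finFieldType)
    (U V : rep Q F) :=
  EquivRel (@ext_equiv n Q F U V) (@ext_equiv_refl n Q F U V)
    (@ext_equiv_sym n Q F U V) (@ext_equiv_trans n Q F U V).

Definition Ext (n : nat) (Q : quiver n) (F : finFieldType) (U V : rep Q F) :
    Type := {eq_quot ext_equiv_equiv U V}.
HB.instance Definition _ (n : nat) (Q : quiver n) (F : finFieldType)
    (U V : rep Q F) := Choice.on (Ext U V).
HB.instance Definition _ (n : nat) (Q : quiver n) (F : finFieldType)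
    (U V : rep Q F) := Quotient.on (Ext U V).

Definition Ext_with_middle (n : nat) (Q : quiver n) (F : finFieldType)
    (U V W : rep Q F) : set (Ext U V) :=
  [set \pi_(Ext U V) x |
    x in [set x : extension U V | isomorphic (ext_middle x) W]].
Arguments Ext_with_middle {n Q F} U V W.

(* The basis element x^a of the underlying vector space is << a >>, and s stands
   for q^(1/2), so that lambda(a, b)^(-1/2) is s ^ (- bform L a b).  The
   multiplication is the bilinear extension of its values on this basis. *)
Definition qmul (C : fieldType) (p : nat) (s : C) (L : 'M[int]_p)
    (f g : {malg C['rV[int]_p]}) : {malg C['rV[int]_p]} :=
  \sum_(a <- msupp f) \sum_(b <- msupp g)
    (f@_a * g@_b) *: (s ^ (- bform L a b) *: << a + b >>).

Definition qchar (C : fieldType) (n r : nat) (s : C) (Q : quiver n)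
    (Qt : quiver (n + r)) (F : finFieldType) (M : rep Q F) :
    {malg C['rV[int]_(n + r)]} :=
  let alpha := dimvec (rdim M) in
  \sum_(c \in [set: {ffun 'I_n -> nat}])
    (s ^ (- bform (euler Q) (dimvec c) (alpha - dimvec c))
       * (ncard (grassmannian c M))%:R) *:
    << gvec Qt alpha - phivec Qt (dimvec c) >>.

(* Main.v *)
From HB Require Import structures.
Require Import Defs.
From mathcomp Require Import all_boot all_order all_algebra ring.
From mathcomp Require Import finmap monalg complex.
From mathcomp Require Import boolp classical_sets functions cardinality fsbigop.
From mathcomp Require Import reals.

(** The coefficients |Ext(U, V)_W| / |Ext(U, V)| are probabilities: a cocycle
    xi, that is one matrix U_(src a) -> V_(tgt a) for each arrow a, has a middle
    representation on V + U whose arrows are block triangular with corner xi,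
    and sending xi to the class of the resulting extension is onto Ext(U, V)
    with all fibres of the same size (card_ext_class), since two cocycles are
    equivalent exactly when they differ by a coboundary.  So the sum over
    isomorphism classes is the average of X(middle of xi) over all cocycles
    (sum_isoclass), and neither Ext groups nor isomorphism classes occur
    afterwards.

    As X(M) is a sum over the subrepresentations N of M, in which N contributes
    a term that depends on the dimension vector of N only (qcharE), the average
    is computed by counting pairs of a cocycle xi and a subrepresentation N of
    its middle.  A family N of subspaces of the spaces V_i + U_i is cut out by
    its images NU in U, its intersections NV with V, and a shear T : U -> V that
    straightens N into NV + NU.  Shearing by T changes xi by the coboundary of
    T, so for each T the number of cocycles that make N stable is 0 unless NU
    and NV are subrepresentations, and otherwise is the number of cocycles that
    carry NU into NV.  On the other hand a given N arises from as many T as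
    there are families of maps U -> V that carry NU into NV.  The matrices
    carrying a subspace A into B have codimension dim A * codim B
    (card_carries); taking this over the vertices and over the arrows leaves the
    factor q to the power sum_i dim NU_i * codim NV_i minus the same sum over
    the arrows, which is the Euler form of dim NU and dim V - dim NV
    (sum_mid_stable).

    Both sides are then sums over pairs (NU, NV) of multiples of the same
    monomial, and it remains to compare powers of q^(1/2) (exponents_match).
    Compatibility says that the form of L pairs phi(c) with y to minus the
    pairing of c with the first n coordinates of y; hence it pairs phi(c) with
    g(a) to the Euler form <c, a>, and phi(c) with phi(c') to the
    antisymmetrized Euler form, and the exponents agree. *)

Set Implicit Arguments.
Unset Strict Implicit.
Unset Printing Implicit Defensive.

Import GRing.Theory Num.Theory.
Local Open Scope ring_scope.
Local Open Scope quotient_scope.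

(** * Counting by fibres *)

(* A subspace is stored as a normalized matrix; this makes the finitely many
   matrices over a finite field visible. *)
Import VectorInternalTheory.
HB.instance Definition _ (F : finFieldType) (vT : vectType F) :=
  [Countable of {vspace vT} by <:].
HB.instance Definition _ (F : finFieldType) (vT : vectType F) :=
  [Finite of {vspace vT} by <:].

Lemma ncardE (T : finType) (A : set T) (P : pred T) :
  (forall t, A t <-> P t) -> ncard A = #|P|.
Proof.
move=> AP; rewrite /ncard; have -> : fset_set A = [fset t | t in P]%fset.
  apply/fsetP => t; rewrite in_fset_set; last exact: finite_finset.
  by rewrite !inE; apply/asboolP/idP => /AP.
by rewrite card_imfset //= -cardE.
Qed.

(** The passage from sums over an infinite index type (dimension vectors,
    isomorphism classes), weighted by the number of objects of each kind, to
    finite sums over the objects themselves. *)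
Lemma sum_fibres (T : finType) (P : pred T) (J : choiceType) (h : T -> J)
    (R : nzRingType) (X : lmodType R) (w : J -> X) :
  \sum_(j \in [set: J]) (#|[pred t | P t & h t == j]|%:R) *: w j
  = \sum_(t | P t) w (h t).
Proof.
rewrite (fsbigTE [fset h t | t in P]%fset) /=; last first.
  move=> j jNP; rewrite [#|_|]eq_card0 ?scale0r // => t; rewrite !inE.
  apply/negP => /andP[Pt /eqP htj]; move/negP: jNP; apply.
  by rewrite -htj; apply/imfsetP; exists t.
transitivity (\sum_(j <- [fset h t | t in P]%fset)
                 \sum_(t | P t) if h t == j then w j else 0).
  apply: eq_bigr => j _; rewrite -big_mkcondr /= sumr_const.
  by rewrite scaler_nat.
rewrite exchange_big /=; apply: eq_bigr => t Pt.
rewrite (big_fsetD1 (h t)) /=; last by apply/imfsetP; exists t.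
rewrite eqxx big1_fset ?addr0 // => j; rewrite !inE eq_sym => /andP[jt _] _.
by rewrite (negbTE jt).
Qed.

Lemma card_const_fibre (A B : finType) (f : A -> B) k :
  (forall b, #|[pred a | f a == b]| = k) -> #|A| = (#|B| * k)%N.
Proof.
move=> fk; rewrite -[LHS]sum1_card (partition_big f xpredT) //=.
rewrite -sum_nat_const; apply: eq_bigr => b _.
by rewrite -(fk b) -sum1_card; apply: eq_bigl.
Qed.

Lemma card_additive_fibre (A B : finZmodType) (f : {additive A -> B}) :
  (forall b, exists a, f a = b) -> #|A| = (#|B| * #|[pred a | f a == 0%R]|)%N.
Proof.
move=> f_surj; apply: (card_const_fibre (f := f)) => b.
have [a0 fa0] := f_surj b.
rewrite -[RHS](fintype.card_image (@addrI _ a0)); apply: eq_card => a.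
rewrite [LHS]inE; apply/eqP/fintype.imageP => [fa|[a1]]; last first.
  by rewrite inE => /eqP fa1 ->; rewrite raddfD /= fa1 addr0.
by exists (a - a0); rewrite ?inE ?raddfB /= ?fa ?fa0 ?subrr // addrC subrK.
Qed.

Lemma card_dffun_pred (I : finType) (T : I -> finType)
    (P : forall i, pred (T i)) :
  #|[pred X : {dffun forall i, T i} | [forall i, P i (X i)]]|
  = (\prod_i #|P i|)%N.
Proof.
rewrite -[RHS]big_enum /= -[RHS](big_map (fun i => #|P i|) xpredT id).
rewrite -foldrE -(card_family P); apply: eq_card => X; rewrite [LHS]inE.
by apply/forallP/familyP.
Qed.

(** * Matrices that carry one subspace into another *)

Lemma vspace_mx (F : fieldType) d (N : {vspace 'rV[F]_d}) :
  exists2 B : 'M[F]_(\dim N, d),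
    row_free B & forall v, (v \in N) = (v <= B)%MS.
Proof.
pose B : 'M[F]_(\dim N, d) := \matrix_i (vbasis N)`_i; have BE (D : 'rV_ _) :
    D *m B = \sum_i D 0 i *: (vbasis N)`_i.
  by rewrite mulmx_sum_row; apply: eq_bigr => i _; rewrite rowK.
exists B => [|v].
  apply: inj_row_free => D; rewrite BE => D0; apply/rowP => i; rewrite mxE.
  by have /freeP/(_ (D 0)) := basis_free (vbasisP N); apply.
apply/idP/submxP => [vN|[D ->]].
  exists (\row_i coord (vbasis N) i v); rewrite BE {1}(coord_vbasis vN).
  by apply: eq_bigr => i _; rewrite mxE.
rewrite BE; apply: memv_suml => i _; apply/memvZ/vbasis_mem/mem_nth.
by rewrite size_tuple.
Qed.

Lemma dimv_rV (F : fieldType) d (N : {vspace 'rV[F]_d}) : (\dim N <= d)%N.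
Proof.
by have [B Bfree _] := vspace_mx N; rewrite -[leqLHS](eqP Bfree) rank_leq_col.
Qed.

Definition carries (F : finFieldType) p q (A : {vspace 'rV[F]_p})
    (B : {vspace 'rV[F]_q}) (X : 'M[F]_(p, q)) : bool :=
  [forall u, (u \in A) ==> (u *m X \in B)].

Lemma carriesP (F : finFieldType) p q (A : {vspace 'rV[F]_p})
    (B : {vspace 'rV[F]_q}) (X : 'M[F]_(p, q)) :
  reflect (forall u, u \in A -> u *m X \in B) (carries A B X).
Proof.
apply: (iffP forallP) => [c u|c u]; first exact/implyP.
by apply/implyP; apply: c.
Qed.

(** With a basis MA of A, and a matrix C with kernel B and independent columns,
    X carries A into B when MA *m X *m C = 0; and X |-> MA *m X *m C is onto the
    matrices with dim A rows and codim B columns. *)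
Lemma card_carries (F : finFieldType) p q (A : {vspace 'rV[F]_p})
    (B : {vspace 'rV[F]_q}) :
  (#|F| ^ (p * q) = #|carries A B| * #|F| ^ (\dim A * (q - \dim B)))%N.
Proof.
have [MA MA_free memA] := vspace_mx A; have [MB /eqP MB_rk memB] := vspace_mx B.
have [K rkK memK] : exists2 K : 'M_q, \rank K = (q - \dim B)%N
    & forall v, (v \in B) = (v *m K == 0).
  exists (cokermx MB) => [|v]; first by rewrite mxrank_coker MB_rk.
  by rewrite memB submxE.
rewrite -rkK -!card_mx mulnC; set C := col_base K.
have memBC v : (v \in B) = (v *m C == 0).
  rewrite memK -[in LHS](mulmx_base K) mulmxA mulmx_free_eq0 //.
  exact: row_base_free.
have C_full : row_full C by exact: col_base_full.
clearbody C.
pose f X := MA *m X *m C.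
have fB : additive f by move=> X Y; rewrite /f mulmxBr mulmxBl.
pose Hf := GRing.isZmodMorphism.Build _ _ f fB.
pose fa : {additive _ -> _} := HB.pack f Hf.
have f_surj Y : exists X, fa X = Y.
  have /row_freeP[A' AA'] := MA_free.
  have /row_fullP[C' C'C] := C_full.
  exists (A' *m Y *m C'); rewrite /fa /= /f !mulmxA AA' mul1mx.
  by rewrite -mulmxA C'C mulmx1.
rewrite (card_additive_fibre f_surj); congr (_ * _)%N.
apply: eq_card => X; rewrite !inE /=; apply/eqP/carriesP => [fX u|cX].
  rewrite memA memBC => /submxP[D ->]; rewrite -!mulmxA.
  by rewrite [MA *m _]mulmxA -/(f X) fX mulmx0.
apply/row_matrixP => i; rewrite /f !row_mul row0; apply/eqP.
by rewrite -memBC cX // memA row_sub.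
Qed.

(** * Subspaces of a direct sum *)

(** Being a direct sum of spaces of dimensions p and q is kept as data on a
    space of dimension d, rather than taking d to be p + q: the dimensions of a
    representation are values of a finite function, so they are sums only up to
    a propositional equality, and the same space is decomposed in several
    ways. *)
Record biproduct (F : fieldType) (p q d : nat) := Biproduct {
  inl : 'M[F]_(p, d);
  inr : 'M[F]_(q, d);
  prl : 'M[F]_(d, p);
  prr : 'M[F]_(d, q);
  inl_prl : inl *m prl = 1%:M;
  inl_prr : inl *m prr = 0;
  inr_prl : inr *m prl = 0;
  inr_prr : inr *m prr = 1%:M;
  bip_sum : prl *m inl + prr *m inr = 1%:M }.

Lemma std_biproduct (F : fieldType) (p q d : nat) :
  d = (p + q)%N -> biproduct F p q d.
Proof.
move=> ->.
exists (row_mx 1%:M 0) (row_mx 0 1%:M) (col_mx 1%:M 0) (col_mx 0 1%:M);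
  rewrite ?mul_row_col ?mulmx0 ?mul0mx ?mulmx1 ?addr0 ?add0r //.
by rewrite !mul_col_row !mulmx0 !mul0mx !mulmx1 add_block_mx !addr0 !add0r
  -scalar_mx_block.
Qed.

(** Another complement to the first summand: the graph of T replaces the second
    summand, while inl and prr do not change. *)
Definition shear (F : fieldType) p q d (b : biproduct F p q d)
  (T : 'M[F]_(q, p)) : biproduct F p q d.
Proof.
exists (inl b) (inr b + T *m inl b) (prl b - prr b *m T) (prr b).
- by rewrite mulmxBr inl_prl mulmxA inl_prr mul0mx subr0.
- exact: inl_prr.
- rewrite mulmxBr !mulmxDl inr_prl -!mulmxA inl_prl [inl b *m _]mulmxA inl_prr.
  by rewrite mul0mx !mulmx0 addr0 mulmx1 mulmxA inr_prr mul1mx add0r subrr.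
- by rewrite mulmxDl inr_prr -mulmxA inl_prr mulmx0 addr0.
- rewrite mulmxBl mulmxDr mulmxA addrCA -addrA addNr addr0 addrC.
  exact: bip_sum.
Defined.

(** The direct sum of B and A inside the space decomposed by b. *)
Definition glue (F : fieldType) p q d (b : biproduct F p q d)
    (A : {vspace 'rV[F]_q}) (B : {vspace 'rV[F]_p}) : {vspace 'rV[F]_d} :=
  (linfun (mulmxr (prr b)) @^-1: A :&: linfun (mulmxr (prl b)) @^-1: B)%VS.

Lemma mem_glue (F : fieldType) p q d (b : biproduct F p q d) A B w :
  (w \in glue b A B) = (w *m prr b \in A) && (w *m prl b \in B).
Proof. by rewrite memv_cap -!memv_preim !lfunE. Qed.

Lemma mem_glue_inl (F : fieldType) p q d (b : biproduct F p q d) A B v :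
  (v *m inl b \in glue b A B) = (v \in B).
Proof.
by rewrite mem_glue -!mulmxA inl_prr inl_prl mulmx0 mulmx1 mem0v.
Qed.

Lemma mem_glue_inr (F : fieldType) p q d (b : biproduct F p q d) A B u :
  (u *m inr b \in glue b A B) = (u \in A).
Proof.
by rewrite mem_glue -!mulmxA inr_prr inr_prl mulmx0 mulmx1 mem0v andbT.
Qed.

Lemma bip_split (F : fieldType) p q d (b : biproduct F p q d) (w : 'rV_d) :
  w = w *m prl b *m inl b + w *m prr b *m inr b.
Proof. by rewrite -!mulmxA -mulmxDr bip_sum mulmx1. Qed.

Lemma dim_glue (F : fieldType) p q d (b : biproduct F p q d) A B :
  \dim (glue b A B) = (\dim A + \dim B)%N.
Proof.
pose r : 'Hom('rV[F]_d, 'rV[F]_q) := linfun (mulmxr (prr b)).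
pose i : 'Hom('rV[F]_p, 'rV[F]_d) := linfun (mulmxr (inl b)).
rewrite -(limg_ker_dim r (glue b A B)) addnC; congr (\dim _ + _)%N.
  apply/vspaceP => u; apply/memv_imgP/idP => [[w + ->]|uA].
    by rewrite mem_glue lfunE => /andP[].
  exists (u *m inr b); first by rewrite mem_glue_inr.
  by rewrite lfunE /= -mulmxA inr_prr mulmx1.
rewrite -[RHS](limg_dim_eq (f := i)).
  congr (\dim _); apply/vspaceP => w; rewrite memv_cap memv_ker lfunE /=.
  apply/andP/memv_imgP => [[wg /eqP wr]|[v vB ->]].
    exists (w *m prl b); first by move: wg; rewrite mem_glue => /andP[].
    by rewrite lfunE /= {1}(bip_split b w) wr mul0mx addr0.
  by rewrite lfunE /= mem_glue_inl -mulmxA inl_prr mulmx0.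
apply/eqP; rewrite -subv0; apply/subvP => v; rewrite memv_cap memv_ker lfunE /=.
move=> /andP[_ /eqP vi]; rewrite memv0 -[v]mulmx1 -(inl_prl b) mulmxA vi.
by rewrite mul0mx.
Qed.

(** A and B are recovered from their sheared sum, as its image and its
    intersection with the first summand; shears that agree on A modulo B put
    the same graph over A. *)
Lemma glue_shear_eq (F : finFieldType) p q d (b : biproduct F p q d)
    (T T' : 'M_(q, p)) A A' B B' :
  glue (shear b T) A B = glue (shear b T') A' B' <->
  [/\ A = A', B = B' & carries A B (T - T')].
Proof.
have shearE (u : 'rV[F]_q) : u *m inr (shear b T) *m prr (shear b T') = u
    /\ u *m inr (shear b T) *m prl (shear b T') = u *m (T - T').
  split; first by rewrite -mulmxA (inr_prr (shear b T)) mulmx1.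
  rewrite -mulmxA /= mulmxBr !mulmxDl inr_prl -!mulmxA inl_prl.
  rewrite [inr b *m _]mulmxA inr_prr [inl b *m _]mulmxA inl_prr mul0mx mulmx0.
  by rewrite mulmx1 mul1mx addr0 add0r.
split=> [eqg|[<- <- /carriesP cT]].
  have eqB : B = B'.
    apply/vspaceP => v.
    by rewrite -(mem_glue_inl (shear b T) A) eqg (mem_glue_inl (shear b T')).
  have subA (X X' : 'M_(q, p)) C C' D D' :
      glue (shear b X) C D = glue (shear b X') C' D' ->
      forall u, u \in C -> u \in C'.
    move=> eqg' u; rewrite -(mem_glue_inr (shear b X) C D) eqg' mem_glue.
    by rewrite -!mulmxA (inr_prr (shear b X)) mulmx1 => /andP[].
  have eqA : A = A'.
    apply/vspaceP => u; apply/idP/idP; [exact: (subA T T' A A' B B')|].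
    exact: (subA T' T A' A B' B).
  split=> //; apply/carriesP => u uA; have [_ <-] := shearE u.
  have := uA; rewrite -(mem_glue_inr (shear b T) A B) eqg mem_glue -eqB.
  by case/andP.
apply/vspaceP => w; rewrite !mem_glue; apply: andb_id2l => wA.
have -> : w *m prl (shear b T') = w *m prl (shear b T) + w *m prr b *m (T - T').
  by rewrite /= !mulmxBr !mulmxA addrA subrK.
by rewrite rpredDr ?cT.
Qed.

(** A linear section of the projection of N onto its image A is defined on A
    only; composing it with the first projection gives T. *)
Lemma glue_surj (F : fieldType) p q d (b : biproduct F p q d) N :
  exists A B (T : 'M[F]_(q, p)), N = glue (shear b T) A B.
Proof.
pose r : 'Hom('rV[F]_d, 'rV[F]_q) := linfun (mulmxr (prr b)).
(* The total linear map g^-1 is a right inverse of g on the image of g, which is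
   the image of N; projecting it to N makes sec take values in N everywhere. *)
pose g : 'Hom('rV[F]_d, 'rV[F]_q) := (r \o projv N)%VF.
pose sec : 'Hom('rV[F]_q, 'rV[F]_d) := (projv N \o g^-1)%VF.
pose i : 'Hom('rV[F]_p, 'rV[F]_d) := linfun (mulmxr (inl b)).
pose T : 'M[F]_(q, p) := lin1_mx sec *m prl b.
have secN u : sec u \in N by rewrite comp_lfunE memv_proj.
have gE w : g w = projv N w *m prr b.
  by rewrite comp_lfunE; exact: lfunE.
have secK w : w \in N -> sec (w *m prr b) *m prr b = w *m prr b.
  move=> wN; have gw : g w = w *m prr b by rewrite gE projv_id.
  rewrite comp_lfunE -gE -gw; apply: limg_lfunVK.
  exact: memv_img (memvf w).
have uT u : u *m T = sec u *m prl b by rewrite mulmxA mul_rV_lin1.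
have splT u : sec u *m prr b = u -> sec u = u *m inr b + u *m T *m inl b.
  by move=> su; rewrite uT {1}(bip_split b (sec u)) su addrC.
exists (r @: N)%VS, (i @^-1: N)%VS, T; apply/vspaceP => w.
rewrite mem_glue /= -memv_preim lfunE /=.
have main u : sec u *m prr b = u -> w *m prr b = u ->
    w *m (prl b - prr b *m T) *m inl b = w - sec u.
  move=> su wu; rewrite splT // mulmxBr mulmxA wu mulmxBl.
  by rewrite {2}(bip_split b w) wu opprD addrA addrK.
apply/idP/andP => [wN|[/memv_imgP[w' w'N wu]]].
  split; last by rewrite (main _ (secK w wN)) // rpredB.
  by apply/memv_imgP; exists w; rewrite ?lfunE.
have {}wu : w *m prr b = w' *m prr b by rewrite wu lfunE.
by rewrite (main _ (secK w' w'N) wu) rpredBr.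
Qed.

Lemma carries_glue (F : finFieldType) p q d p' q' d' (b : biproduct F p q d)
    (b' : biproduct F p' q' d') (M : 'M_(d, d')) A B A' B' :
  inl b *m M *m prr b' = 0 ->
  carries (glue b A B) (glue b' A' B') M =
  [&& carries A A' (inr b *m M *m prr b'), carries B B' (inl b *m M *m prl b')
    & carries A B' (inr b *m M *m prl b')].
Proof.
move=> M0; apply/carriesP/and3P =>
  [cM|[/carriesP cA /carriesP cB /carriesP cAB] w].
  split; apply/carriesP => u uX; rewrite !mulmxA.
  - by have := cM (u *m inr b); rewrite mem_glue_inr mem_glue => /(_ uX)/andP[].
  - by have := cM (u *m inl b); rewrite mem_glue_inl mem_glue => /(_ uX)/andP[].
  - by have := cM (u *m inr b); rewrite mem_glue_inr mem_glue => /(_ uX)/andP[].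
rewrite !mem_glue => /andP[wA wB].
have wE k (X : 'M_(d', k)) : w *m M *m X =
    w *m prl b *m (inl b *m M *m X) + w *m prr b *m (inr b *m M *m X).
  by rewrite {1}(bip_split b w) !mulmxDl !mulmxA.
by rewrite !wE M0 mulmx0 add0r rpredD ?cA ?cB ?cAB.
Qed.

(** * Block triangular matrices *)

Definition blockmx (F : fieldType) p q d p' q' d' (b : biproduct F p q d)
    (b' : biproduct F p' q' d') (A : 'M_(p, p')) (X : 'M_(q, p'))
    (D : 'M_(q, q')) : 'M_(d, d') :=
  prl b *m A *m inl b' + prr b *m X *m inl b' + prr b *m D *m inr b'.

Lemma inl_blockmx (F : fieldType) p q d p' q' d' (b : biproduct F p q d)
    (b' : biproduct F p' q' d') A X D :
  inl b *m blockmx b b' A X D = A *m inl b'.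
Proof.
by rewrite /blockmx !mulmxDr !mulmxA inl_prl inl_prr !mul0mx mul1mx !addr0.
Qed.

Lemma inr_blockmx (F : fieldType) p q d p' q' d' (b : biproduct F p q d)
    (b' : biproduct F p' q' d') A X D :
  inr b *m blockmx b b' A X D = X *m inl b' + D *m inr b'.
Proof.
by rewrite /blockmx !mulmxDr !mulmxA inr_prl inr_prr !mul0mx !mul1mx add0r.
Qed.

Lemma blockmx_prr (F : fieldType) p q d p' q' d' (b : biproduct F p q d)
    (b' : biproduct F p' q' d') A X D :
  blockmx b b' A X D *m prr b' = prr b *m D.
Proof.
rewrite /blockmx !mulmxDl -!(mulmxA _ _ (prr b')) inl_prr inr_prr.
by rewrite !mulmx0 mulmx1 !add0r.
Qed.

(** Used to recognize the arrows of the middle of an extension. *)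
Lemma mx_blockmx (F : fieldType) p q d p' q' d' (b : biproduct F p q d)
    (b' : biproduct F p' q' d') (M : 'M_(d, d')) A X D :
  inl b *m M = A *m inl b' -> inr b *m M = X *m inl b' + D *m inr b' ->
  M = blockmx b b' A X D.
Proof.
move=> iM rM; rewrite -[LHS]mul1mx -(bip_sum b) mulmxDl -!mulmxA iM rM.
by rewrite mulmxDr !mulmxA addrA.
Qed.

(** The corner changes by T *m A - D *m T', which is the coboundary of T when A
    and D are arrows of V and U. *)
Lemma blockmx_shear (F : fieldType) p q d p' q' d' (b : biproduct F p q d)
    (b' : biproduct F p' q' d') A X D T T' :
  blockmx b b' A X D =
  blockmx (shear b T) (shear b' T') A (X + T *m A - D *m T') D.
Proof.
apply: mx_blockmx; first by rewrite /= inl_blockmx.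
rewrite /= [LHS]mulmxDl inr_blockmx -mulmxA inl_blockmx.
rewrite mulmxDr mulmxBl mulmxDl -!mulmxA.
by rewrite [RHS]addrACA addNr addr0 addrAC.
Qed.

Lemma carries_glue_blockmx (F : finFieldType) p q d p' q' d'
    (b : biproduct F p q d) (b' : biproduct F p' q' d')
    X Y Z A B A' B' :
  carries (glue b A B) (glue b' A' B') (blockmx b b' X Y Z) =
  [&& carries A A' Z, carries B B' X & carries A B' Y].
Proof.
rewrite carries_glue -?mulmxA ?blockmx_prr; last first.
  by rewrite mulmxA inl_prr mul0mx.
rewrite !mulmxA inr_prr mul1mx inl_blockmx inr_blockmx mulmxDl -!mulmxA.
by rewrite inl_prl inr_prl mulmx0 !mulmx1 addr0.
Qed.

(** * Quantum cluster characters as sums over subrepresentations *)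

Definition subfam (n : nat) (Q : quiver n) (F : finFieldType) (M : rep Q F) :
    Type := {dffun forall i : 'I_n, {vspace 'rV[F]_(rdim M i)}}.
HB.instance Definition _ (n : nat) (Q : quiver n) (F : finFieldType)
  (M : rep Q F) := Finite.on (subfam M).

Definition stable (n : nat) (Q : quiver n) (F : finFieldType) (M : rep Q F)
    (N : subfam M) : bool :=
  [forall a, carries (N (src a)) (N (tgt a)) (ract M a)].

Definition sdim (n : nat) (Q : quiver n) (F : finFieldType) (M : rep Q F)
    (N : subfam M) : {ffun 'I_n -> nat} := [ffun i => \dim (N i)].

Lemma card_grassmannian (n : nat) (Q : quiver n) (F : finFieldType)
    (M : rep Q F) (c : {ffun 'I_n -> nat}) :
  ncard (grassmannian c M) = #|[pred N : subfam M | stable N & sdim N == c]|.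
Proof.
apply: ncardE => N; split=> [[dimN sN]|/andP[/forallP sN /eqP <-]].
  apply/andP; split; first by apply/forallP => a; apply/carriesP; apply: sN.
  by apply/eqP/ffunP => i; rewrite ffunE.
split=> [i|a]; first by rewrite ffunE.
by apply/carriesP.
Qed.

Definition qchar_term (C : fieldType) (n r : nat) (s : C) (Q : quiver n)
    (Qt : quiver (n + r)) (d c : {ffun 'I_n -> nat}) :
    {malg C['rV[int]_(n + r)]} :=
  s ^ (- bform (euler Q) (dimvec c) (dimvec d - dimvec c)) *:
    << gvec Qt (dimvec d) - phivec Qt (dimvec c) >>.

(** The number of points of the Grassmannian disappears once the sum runs over
    the subrepresentations themselves; this is also what makes the character
    visibly invariant under isomorphism. *)
Lemma qcharE (C : fieldType) (n r : nat) (s : C) (Q : quiver n)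
    (Qt : quiver (n + r)) (F : finFieldType) (M : rep Q F) :
  qchar s Qt M =
  \sum_(N : subfam M | stable N) qchar_term s Q Qt (rdim M) (sdim N).
Proof.
rewrite -(sum_fibres _ (@sdim n Q F M) (qchar_term s Q Qt (rdim M))).
apply: eq_fsbigr => c _; rewrite card_grassmannian /qchar_term scalerA.
by rewrite mulrC.
Qed.

Lemma isomorphic_stable (n : nat) (Q : quiver n) (F : finFieldType)
    (M M' : rep Q F) : isomorphic M M' ->
  exists2 h : subfam M -> subfam M', bijective h &
    forall N, sdim (h N) = sdim N /\ stable (h N) = stable N.
Proof.
move=> /existsP[f isof].
pose im (A B : rep Q F) (g : mxfamily A B) (N : subfam A) : subfam B :=
  [ffun i => (linfun (mulmxr (g i)) @: N i)%VS].
pose g := family_inv f; have isog : is_iso g by apply: family_invP.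
have fg := family_mulV isof; have gf := family_mulVl isof.
have imK (A B : rep Q F) (h : mxfamily A B) (h' : mxfamily B A) :
   (forall i, h i *m h' i = 1%:M) -> cancel (im A B h) (im B A h').
  move=> hh' N; apply/ffunP => i; rewrite !ffunE -limg_comp.
  rewrite -[RHS](lim1g (N i)); congr (_ @: _)%VS; apply/lfunP => v.
  by rewrite comp_lfunE !lfunE /= -mulmxA hh' mulmx1.
have mem_im (A B : rep Q F) (h : mxfamily A B) (N : subfam A) i v :
  v \in N i -> v *m h i \in im A B h N i.
  by move=> vN; rewrite ffunE; apply/memv_imgP; exists v; rewrite ?lfunE.
have im_st (A B : rep Q F) (h : mxfamily A B) (N : subfam A) :
    is_iso h -> stable N -> stable (im A B h N).
  move=> /is_isoP[hh _ _] /forallP sN; apply/forallP => a; apply/carriesP => u.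
  rewrite ffunE => /memv_imgP[v vN ->]; rewrite lfunE /= -mulmxA hh mulmxA.
  by apply: mem_im; apply: (carriesP _ _ _ (sN a)).
exists (im _ _ f) => [|N]; first by exists (im _ _ g); apply: imK.
split; last first.
  apply/idP/idP; last exact: im_st.
  by move=> /(im_st _ _ g _ isog); rewrite imK.
apply/ffunP => i; rewrite !ffunE; apply: limg_dim_eq.
apply/eqP; rewrite -subv0; apply/subvP => v; rewrite memv_cap memv_ker lfunE /=.
move=> /andP[_ /eqP vf]; rewrite memv0 -[v]mulmx1 -(fg i) mulmxA vf.
by rewrite mul0mx.
Qed.

Lemma isomorphic_rdim (n : nat) (Q : quiver n) (F : finFieldType)
    (M M' : rep Q F) : isomorphic M M' -> rdim M = rdim M'.
Proof.
move=> /existsP[f /is_isoP[_ ff fu]]; apply/ffunP => i.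
by rewrite -(eqP (ff i)) (eqP (fu i)).
Qed.

Lemma qchar_iso (C : fieldType) (n r : nat) (s : C) (Q : quiver n)
    (Qt : quiver (n + r)) (F : finFieldType) (M M' : rep Q F) :
  isomorphic M M' -> qchar s Qt M = qchar s Qt M'.
Proof.
move=> isoMM'; have [h h_bij hP] := isomorphic_stable isoMM'.
rewrite !qcharE (reindex h) /=; last exact: onW_bij.
apply: eq_big => [N|N _]; first by rewrite (hP N).2.
by rewrite (hP N).1 (isomorphic_rdim isoMM').
Qed.

(** * Cocycles and their middle representations *)

Definition cocycle (n : nat) (Q : quiver n) (F : finFieldType)
    (U V : rep Q F) : Type :=
  {dffun forall a : arrow Q, 'M[F]_(rdim U (src a), rdim V (tgt a))}.
HB.instance Definition _ (n : nat) (Q : quiver n) (F : finFieldType)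
  (U V : rep Q F) := Finite.on (cocycle U V).

Definition cobound (n : nat) (Q : quiver n) (F : finFieldType)
    (U V : rep Q F) (T : mxfamily U V) : cocycle U V :=
  [ffun a => T (src a) *m ract V a - ract U a *m T (tgt a)].

Lemma coboundE (n : nat) (Q : quiver n) (F : finFieldType)
    (U V : rep Q F) (T : mxfamily U V) a :
  cobound T a = T (src a) *m ract V a - ract U a *m T (tgt a).
Proof. exact: ffunE. Qed.

Definition mid_dim (n : nat) (Q : quiver n) (F : finFieldType)
    (U V : rep Q F) : {ffun 'I_n -> nat} :=
  [ffun i => (rdim V i + rdim U i)%N].

Definition mid_bip (n : nat) (Q : quiver n) (F : finFieldType)
    (U V : rep Q F) (i : 'I_n) :
    biproduct F (rdim V i) (rdim U i) (mid_dim U V i) :=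
  std_biproduct F (ffunE (fun i => (rdim V i + rdim U i)%N) i).

(** In the basis of V + U an extension of U by V is block triangular, because V
    is a subrepresentation and U the quotient; only the corner is free. *)
Definition mid (n : nat) (Q : quiver n) (F : finFieldType)
    (U V : rep Q F) (xi : cocycle U V) : rep Q F :=
  existT _ (mid_dim U V)
    [ffun a => blockmx (mid_bip U V (src a)) (mid_bip U V (tgt a))
                 (ract V a) (xi a) (ract U a)].

Lemma ract_mid (n : nat) (Q : quiver n) (F : finFieldType)
    (U V : rep Q F) (xi : cocycle U V) a :
  ract (mid xi) a = blockmx (mid_bip U V (src a)) (mid_bip U V (tgt a))
                 (ract V a) (xi a) (ract U a).
Proof. exact: ffunE. Qed.

Definition glue_fam (n : nat) (Q : quiver n) (F : finFieldType)
    (U V : rep Q F) (xi : cocycle U V) (NU : subfam U) (NV : subfam V)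
    (T : mxfamily U V) : subfam (mid xi) :=
  [ffun i => glue (shear (mid_bip U V i) (T i)) (NU i) (NV i)].

Lemma glue_famE (n : nat) (Q : quiver n) (F : finFieldType)
    (U V : rep Q F) (xi : cocycle U V) NU NV T i :
  glue_fam xi NU NV T i = glue (shear (mid_bip U V i) (T i)) (NU i) (NV i).
Proof. exact: ffunE. Qed.

Lemma sdim_glue_fam (n : nat) (Q : quiver n) (F : finFieldType)
    (U V : rep Q F) (xi : cocycle U V) NU NV T :
  sdim (glue_fam xi NU NV T) = [ffun i => (sdim NU i + sdim NV i)%N].
Proof. by apply/ffunP => i; rewrite !ffunE glue_famE dim_glue !ffunE. Qed.

(** In the basis sheared by T the corner of each arrow becomes xi + cobound T,
    and a direct sum of subspaces is stable under a block triangular map when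
    each of its blocks carries summand into summand. *)
Lemma stable_glue_fam (n : nat) (Q : quiver n) (F : finFieldType)
    (U V : rep Q F) (xi : cocycle U V) NU NV T :
  stable (glue_fam xi NU NV T) =
  [&& stable NU, stable NV &
    [forall a, carries (NU (src a)) (NV (tgt a)) (xi a + cobound T a)]].
Proof.
have stE a : carries (glue_fam xi NU NV T (src a)) (glue_fam xi NU NV T (tgt a))
      (ract (mid xi) a) =
    [&& carries (NU (src a)) (NU (tgt a)) (ract U a),
        carries (NV (src a)) (NV (tgt a)) (ract V a)
      & carries (NU (src a)) (NV (tgt a)) (xi a + cobound T a)].
  rewrite ract_mid !glue_famE coboundE.
  rewrite (blockmx_shear _ _ _ _ _ (T (src a)) (T (tgt a))).
  by rewrite carries_glue_blockmx addrA.
apply/forallP/and3P => [st|[/forallP sU /forallP sV /forallP sX] a].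
  by split; apply/forallP => a; have := st a; rewrite stE => /and3P[].
by rewrite stE sU sV sX.
Qed.

Definition carries_fam (n : nat) (Q : quiver n) (F : finFieldType)
    (U V : rep Q F) (NU : subfam U) (NV : subfam V) (T : mxfamily U V) : bool :=
  [forall i, carries (NU i) (NV i) (T i)].

Definition carries_cocycle (n : nat) (Q : quiver n) (F : finFieldType)
    (U V : rep Q F) (NU : subfam U) (NV : subfam V) (xi : cocycle U V) : bool :=
  [forall a, carries (NU (src a)) (NV (tgt a)) (xi a)].

Lemma glue_fam_surj (n : nat) (Q : quiver n) (F : finFieldType)
    (U V : rep Q F) (xi : cocycle U V) (N : subfam (mid xi)) :
  exists NU NV T, N = glue_fam xi NU NV T.
Proof.
have /fin_all_exists[x0 NE] i : exists x : {vspace 'rV[F]_(rdim U i)}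
    * {vspace 'rV[F]_(rdim V i)} * 'M[F]_(rdim U i, rdim V i),
    N i = glue (shear (mid_bip U V i) x.2) x.1.1 x.1.2.
  by have [A [B [T ->]]] := glue_surj (mid_bip U V i) (N i); exists (A, B, T).
pose NU : subfam U := [ffun i => (x0 i).1.1].
pose NV : subfam V := [ffun i => (x0 i).1.2].
pose T : mxfamily U V := [ffun i => (x0 i).2].
have [NUE NVE TE] : [/\ forall i, NU i = (x0 i).1.1,
    forall i, NV i = (x0 i).1.2 & forall i, T i = (x0 i).2].
  by split=> i; rewrite ffunE.
by exists NU, NV, T; apply/ffunP => i; rewrite glue_famE NE NUE NVE TE.
Qed.

Lemma glue_fam_eq (n : nat) (Q : quiver n) (F : finFieldType)
    (U V : rep Q F) (xi : cocycle U V) NU NV T NU' NV' T' :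
  glue_fam xi NU NV T = glue_fam xi NU' NV' T' <->
  [/\ NU = NU', NV = NV' & forall i, carries (NU i) (NV i) (T i - T' i)].
Proof.
split=> [/ffunP eqg|[<- <- cT]].
  have g i :
      [/\ NU i = NU' i, NV i = NV' i & carries (NU i) (NV i) (T i - T' i)].
    by have := eqg i; rewrite !glue_famE => /glue_shear_eq.
  by split=> [||i]; do ?[apply/ffunP => i]; case: (g i).
by apply/ffunP => i; rewrite !glue_famE; apply/glue_shear_eq.
Qed.

Lemma carries_fam_gt0 (n : nat) (Q : quiver n) (F : finFieldType)
    (U V : rep Q F) (NU : subfam U) (NV : subfam V) :
  (0 < #|carries_fam (U := U) (V := V) NU NV|)%N.
Proof.
apply/card_gt0P; exists [ffun=> 0]; apply/forallP => i; rewrite ffunE.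
by apply/carriesP => u _; rewrite mulmx0 mem0v.
Qed.

(** The families T that produce a given N form a coset of those that carry NU
    into NV, whence the weight. *)
Lemma sum_glue_fam (n : nat) (Q : quiver n) (F : finFieldType)
    (U V : rep Q F) (xi : cocycle U V) (C : numFieldType) (X : lmodType C)
    (f : subfam (mid xi) -> X) :
  \sum_N f N = \sum_NU \sum_NV \sum_T
    (#|carries_fam (U := U) (V := V) NU NV|%:R)^-1 *: f (glue_fam xi NU NV T).
Proof.
rewrite pair_big pair_big /=.
rewrite (partition_big (fun p => glue_fam xi p.1.1 p.1.2 p.2) xpredT) //=.
apply: eq_bigr => N _; have [NU [NV [T0 ->]]] := glue_fam_surj N.
pose j (T : mxfamily U V) : subfam U * subfam V * mxfamily U V :=
  (NU, NV, [ffun i => T0 i - T i]).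
have j_inj : injective j.
  move=> T T' [/ffunP eqT]; apply/ffunP => i; have := eqT i; rewrite !ffunE.
  by move/addrI/oppr_inj.
have fibreE : [pred p | glue_fam xi p.1.1 p.1.2 p.2 == glue_fam xi NU NV T0]
    =i [seq j T | T in carries_fam NU NV].
  move=> [[NU' NV'] T']; rewrite [LHS]inE /=.
  apply/eqP/fintype.imageP =>
    [/esym/glue_fam_eq[<- <- cT]|[T /forallP cT [-> -> ->]]].
    exists [ffun i => T0 i - T' i].
      by apply/forallP => i; rewrite ffunE.
    by congr (_, _, _); apply/ffunP => i; rewrite !ffunE opprB addrC subrK.
  by apply/esym/glue_fam_eq; split=> // i; rewrite ffunE opprB addrC subrK.
rewrite (eq_bigr (fun=> (#|carries_fam (U := U) (V := V) NU NV|%:R)^-1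
    *: f (glue_fam xi NU NV T0))) => [|p /eqP eqp].
  rewrite (eq_bigl (fun p => p \in [seq j T | T in carries_fam NU NV])).
    rewrite sumr_const fintype.card_image // -scaler_nat scalerA.
    by rewrite divff ?scale1r // pnatr_eq0 -lt0n carries_fam_gt0.
  exact: fibreE.
by rewrite eqp; have /glue_fam_eq[-> -> _] := eqp.
Qed.

(** Together with its analogue for cocycles: the exponents over the vertices and
    over the arrows are the two halves of the Euler form. *)
Lemma card_carries_fam (n : nat) (Q : quiver n) (F : finFieldType)
    (U V : rep Q F) (NU : subfam U) (NV : subfam V) :
  #|{: mxfamily U V}| = (#|carries_fam (U := U) (V := V) NU NV|
    * #|F| ^ (\sum_i sdim NU i * (rdim V i - sdim NV i)))%N.
Proof.
rewrite -(cardsT (mxfamily U V)).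
have -> : #|[set: mxfamily U V]|
    = (\prod_i #|{: 'M[F]_(rdim U i, rdim V i)}|)%N.
  rewrite -(card_dffun_pred
    (fun i => xpredT : pred 'M[F]_(rdim U i, rdim V i))).
  by apply: eq_card => X; rewrite !inE; apply/esym/forallP.
rewrite (card_dffun_pred (fun i => carries (NU i) (NV i))).
rewrite expn_sum -big_split /=.
by apply: eq_bigr => i _; rewrite card_mx (card_carries (NU i) (NV i)) !ffunE.
Qed.

Lemma card_carries_cocycle (n : nat) (Q : quiver n) (F : finFieldType)
    (U V : rep Q F) (NU : subfam U) (NV : subfam V) :
  #|{: cocycle U V}| = (#|carries_cocycle (U := U) (V := V) NU NV|
    * #|F| ^ (\sum_(a : arrow Q) sdim NU (src a)
                * (rdim V (tgt a) - sdim NV (tgt a))))%N.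
Proof.
rewrite -(cardsT (cocycle U V)).
have -> : #|[set: cocycle U V]|
    = (\prod_(a : arrow Q) #|{: 'M[F]_(rdim U (src a), rdim V (tgt a))}|)%N.
  rewrite -(card_dffun_pred
    (fun a => xpredT : pred 'M[F]_(rdim U (src a), rdim V (tgt a)))).
  by apply: eq_card => X; rewrite !inE; apply/esym/forallP.
rewrite (card_dffun_pred (fun a => carries (NU (src a)) (NV (tgt a)))).
rewrite expn_sum -big_split /=.
apply: eq_bigr => a _.
by rewrite card_mx (card_carries (NU (src a)) (NV (tgt a))) !ffunE.
Qed.

Lemma bform_euler (n : nat) (Q : quiver n) (x y : 'rV[int]_n) :
  bform (euler Q) x y = \sum_i x 0 i * y 0 i
    - \sum_(a : arrow Q) x 0 (src a) * y 0 (tgt a).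
Proof.
rewrite /bform mxE.
have -> : \sum_(a : arrow Q) x 0 (src a) * y 0 (tgt a)
    = \sum_j (\sum_i x 0 i * (narrows Q i j)%:Z) * y 0 j.
  rewrite (partition_big (@tgt n Q) xpredT) //=; apply: eq_bigr => j _.
  rewrite mulr_suml (partition_big (@src n Q) xpredT) //=.
  apply: eq_bigr => i _.
  rewrite (eq_bigr (fun=> x 0 i * y 0 j)) => [|a /andP[/eqP -> /eqP ->] //].
  rewrite sumr_const -mulr_natr mulrAC /narrows natz.
  by congr (_ * _%:Z * _); apply: eq_card => a; rewrite !inE andbC.
rewrite -sumrB; apply: eq_bigr => j _; rewrite -mulrBl [y^T _ _]mxE.
congr (_ * _); rewrite mxE (eq_bigr (fun i =>
  (if i == j then x 0 i else 0) - x 0 i * (narrows Q i j)%:Z)).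
  by rewrite sumrB -big_mkcond big_pred1_eq.
by move=> i _; rewrite mxE mulrBr; case: eqP => _; rewrite ?mulr1 ?mulr0.
Qed.

Lemma carries_cocycle_gt0 (n : nat) (Q : quiver n) (F : finFieldType)
    (U V : rep Q F) (NU : subfam U) (NV : subfam V) :
  (0 < #|carries_cocycle (U := U) (V := V) NU NV|)%N.
Proof.
apply/card_gt0P; exists [ffun=> 0]; apply/forallP => a; rewrite ffunE.
by apply/carriesP => u _; rewrite mulmx0 mem0v.
Qed.

Lemma bform_euler_sdim (n : nat) (Q : quiver n) (F : finFieldType)
    (U V : rep Q F) (NU : subfam U) (NV : subfam V) :
  bform (euler Q) (dimvec (sdim NU)) (dimvec (rdim V) - dimvec (sdim NV)) =
    (\sum_i sdim NU i * (rdim V i - sdim NV i))%N%:Z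
    - (\sum_(a : arrow Q) sdim NU (src a)
                * (rdim V (tgt a) - sdim NV (tgt a)))%N%:Z.
Proof.
rewrite bform_euler -!natz !natr_sum.
have dE i : (rdim V i - sdim NV i)%N%:R
    = (dimvec (rdim V) - dimvec (sdim NV)) 0 i.
  by rewrite !mxE ffunE natrB ?dimv_rV // !natz.
by congr (_ - _); apply: eq_bigr => i _; rewrite natrM dE !mxE natz.
Qed.

(** Translation by eta permutes the cocycles, so the shear T does not influence
    the count. *)
Lemma sum_cocycle_shift (n : nat) (Q : quiver n) (F : finFieldType)
    (U V : rep Q F) (NU : subfam U) (NV : subfam V) (eta : cocycle U V)
    (C : numFieldType) (X : lmodType C) (W : X) :
  \sum_(xi : cocycle U V)
     (if carries_cocycle NU NV [ffun a => xi a + eta a] then W else 0) =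
  #|carries_cocycle (U := U) (V := V) NU NV|%:R *: W.
Proof.
rewrite scaler_nat -sumr_const [RHS]big_mkcond /=.
have sub_bij : bijective (fun xi : cocycle U V =>
    [ffun a => xi a - eta a] : cocycle U V).
  exists (fun xi : cocycle U V => [ffun a => xi a + eta a]) => xi;
    by apply/ffunP => a; rewrite !ffunE ?subrK ?addrK.
rewrite (reindex _ (onW_bij _ sub_bij)) /=; apply: eq_bigr => xi _.
congr (if _ then _ else _); apply: eq_forallb => a.
by rewrite !ffunE subrK.
Qed.

(** The factor is |Hom(NU, V/NV)| / |Ext(NU, V/NV)|, but it is reached by
    counting shears and cocycles, without forming these groups. *)
Lemma sum_mid_stable (n : nat) (Q : quiver n) (F : finFieldType)
    (U V : rep Q F) (C : numFieldType) (X : lmodType C)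
    (w : {ffun 'I_n -> nat} -> X) :
  (#|{: cocycle U V}|%:R)^-1 *:
    \sum_(xi : cocycle U V) \sum_(N : subfam (mid xi) | stable N) w (sdim N) =
  \sum_(NU : subfam U | stable NU) \sum_(NV : subfam V | stable NV)
    (#|F|%:R ^ bform (euler Q) (dimvec (sdim NU))
                 (dimvec (rdim V) - dimvec (sdim NV))) *:
    w [ffun i => (sdim NU i + sdim NV i)%N].
Proof.
rewrite (eq_bigr (fun xi : cocycle U V =>
  \sum_(NU : subfam U) \sum_(NV : subfam V) \sum_(T : mxfamily U V)
    (#|carries_fam (U := U) (V := V) NU NV|%:R)^-1 *:
      if [&& stable NU, stable NV & carries_cocycle NU NV
           [ffun a => xi a + cobound T a]]
      then w [ffun i => (sdim NU i + sdim NV i)%N] else 0)); last first.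
  move=> xi _; rewrite big_mkcond sum_glue_fam; apply: eq_bigr => NU _.
  apply: eq_bigr => NV _; apply: eq_bigr => T _; congr (_ *: _).
  rewrite stable_glue_fam sdim_glue_fam; congr (if [&& _, _ & _] then _ else _).
  by apply: eq_forallb => a; rewrite [in RHS]ffunE.
(* Compare the contributions of each pair (NU, NV). *)
rewrite exchange_big scaler_sumr [RHS]big_mkcond /=; apply: eq_bigr => NU _.
rewrite exchange_big scaler_sumr /=.
have [sU|_] := boolP (stable NU); last first.
  rewrite big1 // => NV _; rewrite big1 ?scaler0 // => xi _.
  by rewrite big1 // => T _; rewrite scaler0.
rewrite [RHS]big_mkcond /=; apply: eq_bigr => NV _.
have [sV|_] := boolP (stable NV); last first.
  by rewrite big1 ?scaler0 // => xi _; rewrite big1 // => T _; rewrite scaler0.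
set W := w _; rewrite /= exchange_big /=.
under eq_bigr do rewrite -scaler_sumr sum_cocycle_shift.
rewrite sumr_const -scaler_nat !scalerA; congr (_ *: _).
have q0 : #|F|%:R != 0 :> C.
  by rewrite pnatr_eq0 -lt0n; apply/card_gt0P; exists 0.
rewrite bform_euler_sdim expfzDr // -exprnN -exprnP.
have := carries_fam_gt0 NU NV; rewrite lt0n -(pnatr_eq0 C) => K0.
have := carries_cocycle_gt0 NU NV; rewrite lt0n -(pnatr_eq0 C) => K1.
rewrite (card_carries_fam NU NV) (card_carries_cocycle NU NV) !natrM !natrX.
move: (expf_neq0 (\sum_(a : arrow Q) sdim NU (src a)
  * (rdim V (tgt a) - sdim NV (tgt a))) q0).
move: (_ ^+ _) (_ ^+ _) => y x x0.
by field; rewrite x0 K0 K1.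
Qed.

(** * Extensions and cocycles *)

(** The isomorphism that identifies the summands of two decompositions. *)
Definition change_bip (F : fieldType) p q d e (b : biproduct F p q d)
    (b' : biproduct F p q e) : 'M_(d, e) :=
  prl b *m inl b' + prr b *m inr b'.

Lemma inl_change (F : fieldType) p q d e (b : biproduct F p q d)
    (b' : biproduct F p q e) : inl b *m change_bip b b' = inl b'.
Proof. by rewrite mulmxDr !mulmxA inl_prl inl_prr mul1mx mul0mx addr0. Qed.

Lemma inr_change (F : fieldType) p q d e (b : biproduct F p q d)
    (b' : biproduct F p q e) : inr b *m change_bip b b' = inr b'.
Proof. by rewrite mulmxDr !mulmxA inr_prl inr_prr mul1mx mul0mx add0r. Qed.

Lemma change_prr (F : fieldType) p q d e (b : biproduct F p q d)
    (b' : biproduct F p q e) : change_bip b b' *m prr b' = prr b.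
Proof.
by rewrite mulmxDl -!mulmxA inl_prr inr_prr mulmx1 mulmx0 add0r.
Qed.

Lemma changeK (F : fieldType) p q d e (b : biproduct F p q d)
    (b' : biproduct F p q e) : change_bip b b' *m change_bip b' b = 1%:M.
Proof.
by rewrite mulmxDl -!mulmxA inl_change inr_change bip_sum.
Qed.

Lemma blockmx_change (F : fieldType) p q d e p' q' d' e'
    (b : biproduct F p q d) (c : biproduct F p q e)
    (b' : biproduct F p' q' d') (c' : biproduct F p' q' e') A X D :
  change_bip b c *m blockmx c c' A X D = blockmx b b' A X D *m change_bip b' c'.
Proof.
rewrite mulmxDl -!mulmxA inl_blockmx inr_blockmx /blockmx !mulmxDl -!mulmxA.
by rewrite inl_change inr_change mulmxDr addrA.
Qed.

(** Short exact sequences of vector spaces split. *)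
Lemma exact_biproduct (F : fieldType) p q d (f : 'M[F]_(p, d))
    (g : 'M[F]_(d, q)) :
  row_free f -> row_full g -> (f == kermx g)%MS ->
  exists2 b : biproduct F p q d, inl b = f & prr b = g.
Proof.
move=> f_free /row_fullP[sec secg] /andP[fg gf].
have {}fg : f *m g = 0 by apply/sub_kermxP.
(* 1 - g *m sec projects onto the kernel of g, which is the image of f. *)
have ret : (1%:M - g *m sec) *m pinvmx f *m f = 1%:M - g *m sec.
  apply: mulmxKpV; apply: submx_trans gf; apply/sub_kermxP.
  by rewrite mulmxBl mul1mx -mulmxA secg mulmx1 subrr.
pose l := (1%:M - g *m sec) *m pinvmx f.
have lf : l *m f = 1%:M - g *m sec by [].
have fl : f *m l = 1%:M.
  apply: (row_free_inj f_free); rewrite -mulmxA lf mulmxBr mulmxA fg mul0mx.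
  by rewrite mulmx1 mul1mx subr0.
have sl : sec *m l = 0.
  apply: (row_free_inj f_free); rewrite -mulmxA lf mulmxBr mulmxA secg.
  by rewrite mul1mx mulmx1 subrr mul0mx.
have bs : l *m f + g *m sec = 1%:M by rewrite lf subrK.
by exists (Biproduct fl fg sl secg bs).
Qed.

Definition mid_incl (n : nat) (Q : quiver n) (F : finFieldType)
    (U V : rep Q F) (xi : cocycle U V) : mxfamily V (mid xi) :=
  [ffun i => inl (mid_bip U V i)].

Definition mid_proj (n : nat) (Q : quiver n) (F : finFieldType)
    (U V : rep Q F) (xi : cocycle U V) : mxfamily (mid xi) U :=
  [ffun i => prr (mid_bip U V i)].

Lemma mid_inclE (n : nat) (Q : quiver n) (F : finFieldType)
    (U V : rep Q F) (xi : cocycle U V) i :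
  mid_incl xi i = inl (mid_bip U V i).
Proof. exact: ffunE. Qed.

Lemma mid_projE (n : nat) (Q : quiver n) (F : finFieldType)
    (U V : rep Q F) (xi : cocycle U V) i :
  mid_proj xi i = prr (mid_bip U V i).
Proof. exact: ffunE. Qed.

Lemma mid_is_extension (n : nat) (Q : quiver n) (F : finFieldType)
    (U V : rep Q F) (xi : cocycle U V) :
  @is_extension n Q F U V (existT _ (mid xi) (mid_incl xi, mid_proj xi)).
Proof.
apply/and3P; split.
- apply/andP; split; apply/forallP => x; rewrite !mid_inclE.
    by rewrite ract_mid inl_blockmx.
  by apply/row_freeP; exists (prl (mid_bip U V x)); apply: inl_prl.
- apply/andP; split; apply/forallP => x; rewrite !mid_projE.
    by rewrite ract_mid blockmx_prr.
  by apply/row_fullP; exists (inr (mid_bip U V x)); apply: inr_prr.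
- apply/forallP => i; rewrite mid_inclE mid_projE; apply/andP; split.
    by apply/sub_kermxP; apply: inl_prr.
  rewrite -[kermx _]mulmx1 -(bip_sum (mid_bip U V i)) mulmxDr.
  by rewrite [X in _ + X]mulmxA mulmx_ker mul0mx addr0 mulmxA submxMl.
Qed.

Definition mid_ext (n : nat) (Q : quiver n) (F : finFieldType)
    (U V : rep Q F) (xi : cocycle U V) : extension U V :=
  exist (fun x : preextension U V => is_extension x) _ (mid_is_extension xi).

Definition ext_class (n : nat) (Q : quiver n) (F : finFieldType)
    (U V : rep Q F) (xi : cocycle U V) : Ext U V := \pi_(Ext U V) (mid_ext xi).

(** Splitting the sequence at each vertex makes the arrows block triangular, and
    the corner is the cocycle. *)
Lemma mid_ext_surj (n : nat) (Q : quiver n) (F : finFieldType)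
    (U V : rep Q F) (x : extension U V) :
  exists xi, ext_equiv x (mid_ext xi).
Proof.
case: x => [[E [f g]] /= Hx]; have := Hx.
move=> /and3P[/andP[/forallP fh /forallP ff] /andP[/forallP gh /forallP gf]].
move=> /forallP fg.
have /fin_all_exists2[b bf bg] i : exists2 b : biproduct F _ _ _,
    inl b = f i & prr b = g i by apply: exact_biproduct.
pose xi : cocycle U V :=
  [ffun a => inr (b (src a)) *m ract E a *m prl (b (tgt a))].
have xiE a : xi a = inr (b (src a)) *m ract E a *m prl (b (tgt a)).
  by rewrite ffunE.
have EE a : ract E a = blockmx (b (src a)) (b (tgt a))
    (ract V a) (xi a) (ract U a).
  apply: mx_blockmx; first by rewrite !bf; apply/eqP.
  rewrite xiE -[LHS]mulmx1 -(bip_sum (b (tgt a))) mulmxDr !mulmxA.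
  congr (_ + _ *m _); rewrite -mulmxA bg -(eqP (gh a)) -bg mulmxA inr_prr.
  by rewrite mul1mx.
pose h : mxfamily E (mid xi) := [ffun i => change_bip (b i) (mid_bip U V i)].
have hE i : h i = change_bip (b i) (mid_bip U V i) by exact: ffunE.
exists xi; apply/existsP; exists h; apply/and3P; split.
- apply/is_isoP; split=> [a|i|i]; rewrite !hE.
  + by rewrite ract_mid EE; apply: blockmx_change.
  + apply/row_freeP; exists (change_bip (mid_bip U V i) (b i)).
    exact: changeK.
  + apply/row_fullP; exists (change_bip (mid_bip U V i) (b i)).
    exact: changeK.
- apply/eqP/ffunP => i; rewrite family_mulE hE /ext_incl /=.
  by rewrite mid_inclE -bf inl_change.
- apply/eqP/ffunP => i; rewrite family_mulE hE /ext_proj /=.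
  by rewrite mid_projE -bg change_prr.
Qed.

(** An equivalence of extensions is the identity on V and on U, hence is a shear
    by some T. *)
Lemma ext_class_eq (n : nat) (Q : quiver n) (F : finFieldType)
    (U V : rep Q F) (xi xi' : cocycle U V) :
  ext_class xi = ext_class xi' <->
  exists T : mxfamily U V, forall a, xi a - xi' a = cobound T a.
Proof.
have -> : (ext_class xi = ext_class xi')
    <-> ext_equiv (mid_ext xi) (mid_ext xi').
  by split=> [/eqquotP|eq]; last apply/eqquotP.
split=> [/existsP[h /and3P[/is_isoP[hh _ _] /eqP/ffunP hi /eqP/ffunP hp]]
        |[T dT]].
  pose b := mid_bip U V.
  pose T : mxfamily U V := [ffun i => inr (b i) *m h i *m prl (b i)].
  have TE i : T i = inr (b i) *m h i *m prl (b i) by rewrite ffunE.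
  have inr_h i : inr (b i) *m h i = T i *m inl (b i) + inr (b i).
    rewrite -[LHS]mulmx1 -(bip_sum (b i)) mulmxDr TE !mulmxA; congr (_ + _).
    have := hp i; rewrite family_mulE /ext_proj /= !mid_projE -/(b i).
    by rewrite -(mulmxA (inr _)) => ->; rewrite inr_prr mul1mx.
  have inl_h i : inl (b i) *m h i = inl (b i).
    by have := hi i; rewrite family_mulE /ext_incl /= !mid_inclE.
  exists T => a; have := hh a; rewrite /= !ract_mid -!/(b _) coboundE.
  move=> /(congr1 (fun M => inr (b (src a)) *m M *m prl (b (tgt a)))).
  rewrite !mulmxA inr_blockmx inr_h.
  rewrite !mulmxDl -!mulmxA (mulmxA (inl _) (h _)) inl_h.
  rewrite (mulmxA (inr _) (h _)) inr_h.
  rewrite (mulmxA (inl _)) inl_blockmx (mulmxA (inr _)) inr_blockmx !mulmxDl.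
  rewrite -!mulmxA inl_prl inr_prl !mulmx0 !addr0 !mulmx1 => eqT.
  by apply/eqP; rewrite subr_eq addrAC eqT addrK.
pose b := mid_bip U V.
pose h : mxfamily (mid xi) (mid xi') :=
  [ffun i => change_bip (b i) (shear (b i) (T i))].
have hE i : h i = change_bip (b i) (shear (b i) (T i)) by exact: ffunE.
apply/existsP; exists h; apply/and3P; split.
- apply/is_isoP; split=> [a|i|i]; rewrite !hE.
  + rewrite /= !ract_mid -!/(b _).
    rewrite (blockmx_shear _ _ _ (xi' a) _ (T (src a)) (T (tgt a))).
    rewrite -addrA -coboundE -dT addrC subrK.
    exact: blockmx_change.
  + apply/row_freeP; exists (change_bip (shear (b i) (T i)) (b i)).
    exact: changeK.
  + apply/row_fullP; exists (change_bip (shear (b i) (T i)) (b i)).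
    exact: changeK.
- apply/eqP/ffunP => i; rewrite family_mulE hE /ext_incl /= !mid_inclE.
  exact: inl_change.
- apply/eqP/ffunP => i; rewrite family_mulE hE /ext_proj /= !mid_projE.
  exact: (change_prr (b i) (shear (b i) (T i))).
Qed.

Lemma card_preim_ncard (T : finType) (J : choiceType) (f : T -> J) k
    (A : set J) :
  (forall j, exists t, f t = j) ->
  (forall t, #|[pred t' | f t' == f t]| = k) ->
  #|[pred t | f t \in A]| = (ncard A * k)%N.
Proof.
move=> f_surj fk; pose B := [fset f t | t in [pred t | f t \in A]]%fset.
have B_A j : (j \in B) = (j \in A).
  have [t <-] := f_surj j; apply/imfsetP/idP => [[t' + ->]|ftA] //.
  by exists t.
have -> : ncard A = #|` B|%fset.
  rewrite /ncard; have -> : A = [set` B]%classic.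
    by apply/seteqP; split=> j; [move=> /mem_set | move=> jB; apply/set_mem];
      rewrite -B_A.
  by rewrite set_fsetK.
rewrite -sum1_card.
transitivity (\sum_(t | f t \in A) \sum_(j <- B | f t == j) 1)%N.
  apply: eq_bigr => t ftA; have ftB : f t \in B by rewrite B_A.
  rewrite (eq_bigl (pred1 (f t))) => [|j]; last exact: eq_sym.
  by rewrite -big_filter filter_pred1_uniq ?fset_uniq // big_seq1.
rewrite (exchange_big_dep xpredT) //=.
transitivity (\sum_(j <- B) k)%N.
  rewrite !big_seq; apply: eq_bigr => j; rewrite B_A.
  have [t0 <-] := f_surj j => t0A; rewrite -(fk t0) -sum1_card.
  apply: eq_bigl => t; rewrite inE andbC; case: eqP => [->|] //.
by rewrite big_const_seq count_predT iter_addn_0 mulnC.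
Qed.

(** The fibres are cosets of the coboundaries, so any set of classes has a
    cardinality proportional to that of its inverse image. *)
Lemma card_ext_class (n : nat) (Q : quiver n) (F : finFieldType)
    (U V : rep Q F) :
  exists2 k, (0 < k)%N & forall A : set (Ext U V),
    #|[pred xi : cocycle U V | ext_class xi \in A]| = (ncard A * k)%N.
Proof.
pose B := [pred eta : cocycle U V |
  [exists T : mxfamily U V, eta == cobound T]].
have bij_sub (xi : cocycle U V) :
    injective (fun eta : cocycle U V => [ffun a => xi a - eta a] : cocycle U V).
  move=> eta eta' /ffunP eqe; apply/ffunP => a; have := eqe a; rewrite !ffunE.
  by move/addrI/oppr_inj.
exists #|B| => [|A].
  apply/card_gt0P; exists (cobound [ffun=> 0]); apply/existsP.
  by exists [ffun=> 0].
apply: card_preim_ncard => [j|xi].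
  elim/quotW: j => x; have [xi eqx] := mid_ext_surj x; exists xi.
  by apply/esym/eqquotP.
rewrite -[RHS](fintype.card_image (bij_sub xi)); apply: eq_card => xi'.
rewrite [LHS]inE; apply/eqP/fintype.imageP => [/esym/ext_class_eq[T dT]|].
  exists (cobound T); first by apply/existsP; exists T.
  by apply/ffunP => a; rewrite [RHS]ffunE -dT opprB addrC subrK.
move=> [eta /existsP[T /eqP ->] ->]; apply/esym/ext_class_eq; exists T => a.
by rewrite [X in _ - X]ffunE opprB addrC subrK.
Qed.

(** The two instances needed, with the same proportionality factor k, which
    cancels in the ratio of the numbers of extension classes. *)
Lemma card_Ext (n : nat) (Q : quiver n) (F : finFieldType) (U V : rep Q F) :
  exists2 k, (0 < k)%N & (forall W, 
    #|[pred xi : cocycle U V | isomorphic (mid xi) W]|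
      = (ncard (Ext_with_middle U V W) * k)%N) /\
    #|{: cocycle U V}| = (ncard [set: Ext U V]%classic * k)%N.
Proof.
have [k k_gt0 kA] := card_ext_class U V.
exists k => //; split=> [W|]; last first.
  by rewrite -kA; apply: eq_card => xi; rewrite !inE in_setT.
rewrite -kA; apply: eq_card => xi; rewrite !inE.
apply/idP/asboolP => [iso|[x /= isox /eqquotP/existsP[h /and3P[isoh _ _]]]].
  by exists (mid_ext xi).
apply: isomorphic_trans isox; rewrite isomorphic_sym; apply/existsP.
by exists h.
Qed.

Local Open Scope classical_set_scope.

(** Both counts of classes become counts of cocycles, and summing over the
    isomorphism class of the middle is then summing over the cocycles. *)
Lemma sum_isoclass (R : numFieldType) (n : nat) (Q : quiver n)
    (F : finFieldType) (U V : rep Q F) (X : lmodType R) (f : rep Q F -> X) :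
  (forall M M', isomorphic M M' -> f M = f M') ->
  \sum_(W \in [set: isoclass Q F])
    ((ncard (Ext_with_middle U V (repr W)))%:R / (ncard [set: Ext U V])%:R)
      *: f (repr W) =
  (#|{: cocycle U V}|%:R)^-1 *: \sum_(xi : cocycle U V) f (mid xi).
Proof.
move=> f_iso; have [k k_gt0 [kW kT]] := card_Ext U V.
pose cl (xi : cocycle U V) : isoclass Q F := \pi_(isoclass Q F) (mid xi).
rewrite kT scaler_sumr.
pose w (W : isoclass Q F) :=
  ((ncard [set: Ext U V] * k)%N%:R)^-1 *: f (repr W) : X.
 transitivity (\sum_(xi : cocycle U V) w (cl xi)).
  rewrite -(sum_fibres xpredT cl w); apply: eq_fsbigr => W _.
  rewrite /w scalerA; congr (_ *: _).
  have -> : #|[pred xi | xpredT xi & cl xi == W]|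
      = (ncard (Ext_with_middle U V (repr W)) * k)%N.
    rewrite -kW; apply: eq_card => xi; rewrite !inE /= -{1}[W]reprK.
    by apply/eqP/idP => [/eqquotP //|iso]; apply/eqquotP.
  rewrite !natrM invfM mulrACA divff ?mulr1 //.
  by rewrite pnatr_eq0 -lt0n.
apply: eq_bigr => xi _; congr (_ *: _); apply: f_iso.
by have /eqquotP := reprK (cl xi).
Qed.

(** * Multiplication in the quantum Laurent polynomial algebra *)

(** The linear extension of h from monomials to polynomials; qmul is obtained by
    applying it twice. *)
Definition msum (K : choiceType) (C : nzRingType) (X : lmodType C) (h : K -> X)
  (f : {malg C[K]}) : X := \sum_(a <- msupp f) f@_a *: h a.

Lemma msumE (K : choiceType) (C : nzRingType) (X : lmodType C) (h : K -> X)
  (f : {malg C[K]}) (D : {fset K}) :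
  (msupp f `<=` D)%fset -> msum h f = \sum_(a <- D) f@_a *: h a.
Proof.
move=> fD; apply: big_fset_incl => // a _ /mcoeff_outdom ->.
by rewrite scale0r.
Qed.

(** The monomials m i may collide, so this is more than a change of index. *)
Lemma msum_sum (K : choiceType) (C : nzRingType) (X : lmodType C) (h : K -> X)
    (I : Type) (r : seq I) (P : pred I) (c : I -> C) (m : I -> K) :
  msum h (\sum_(i <- r | P i) c i *: << m i >>) =
  \sum_(i <- r | P i) c i *: h (m i).
Proof.
elim/big_rec2: _ => [|i y f Pi <-]; first by rewrite /msum msupp0 big_seq_fset0.
pose D := (msupp f `|` [fset m i])%fset.
have fD : (msupp f `<=` D)%fset by apply: fsubsetUl.
have iD : m i \in D by rewrite !inE eqxx orbT.
rewrite !(@msumE _ _ _ _ _ D) //; last first.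
  apply/fsubsetP => a; rewrite -mcoeff_neq0 mcoeffD mcoeffZ mcoeffU !inE.
  rewrite -mcoeff_neq0 [a == _]eq_sym; case: (m i == a); rewrite ?orbT //.
  by rewrite mulr0 add0r orbF.
have -> : c i *: h (m i) = \sum_(a <- D) (c i *: << m i >>)@_a *: h a.
  rewrite (big_fsetD1 (m i)) //= mcoeffZ mcoeffU eqxx mulr1 big1_fset ?addr0 //.
  move=> a; rewrite !inE => /andP[ai _] _; rewrite mcoeffZ mcoeffU eq_sym.
  by rewrite (negbTE ai) mulr0 scale0r.
by rewrite -big_split /=; apply: eq_bigr => a _; rewrite mcoeffD scalerDl.
Qed.

Lemma qmul_sum (C : fieldType) (p : nat) (s : C) (L : 'M[int]_p)
    (I J : Type) (r : seq I) (P : pred I) (c : I -> C) (m : I -> 'rV[int]_p)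
    (r' : seq J) (P' : pred J) (c' : J -> C) (m' : J -> 'rV[int]_p) :
  qmul s L (\sum_(i <- r | P i) c i *: << m i >>)
           (\sum_(j <- r' | P' j) c' j *: << m' j >>) =
  \sum_(i <- r | P i) \sum_(j <- r' | P' j)
    (c i * c' j * s ^ (- bform L (m i) (m' j))) *: << m i + m' j >>.
Proof.
set f := (X in qmul _ _ X _); set g := (X in qmul _ _ _ X).
have -> : qmul s L f g =
    msum (fun a => msum (fun b => s ^ (- bform L a b) *: << a + b >>) g) f.
  apply: eq_bigr => a _; rewrite scaler_sumr; apply: eq_bigr => b _.
  by rewrite -scalerA.
rewrite msum_sum; apply: eq_bigr => i _; rewrite msum_sum scaler_sumr.
by apply: eq_bigr => j _; rewrite !scalerA.
Qed.

(** * Bilinear forms and compatibility *)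

Lemma bformDl p (A : 'M[int]_p) x y z :
  bform A (x + y) z = bform A x z + bform A y z.
Proof. by rewrite /bform !mulmxDl mxE. Qed.

Lemma bformDr p (A : 'M[int]_p) x y z :
  bform A x (y + z) = bform A x y + bform A x z.
Proof. by rewrite /bform linearD mulmxDr mxE. Qed.

Lemma bformNl p (A : 'M[int]_p) x y : bform A (- x) y = - bform A x y.
Proof. by rewrite /bform !mulNmx mxE. Qed.

Lemma bformNr p (A : 'M[int]_p) x y : bform A x (- y) = - bform A x y.
Proof. by rewrite /bform linearN mulmxN mxE. Qed.

Lemma bform_tr p (A : 'M[int]_p) x y : bform A^T x y = bform A y x.
Proof.
rewrite /bform; have -> : y *m A *m x^T = (x *m A^T *m y^T)^T.
  by rewrite !trmx_mul !trmxK mulmxA.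
by rewrite [RHS]mxE.
Qed.

Lemma euler_extended (n r : nat) (Q : quiver n) (Qt : quiver (n + r)) :
  extended_quiver Q Qt -> ulsubmx (euler Qt) = euler Q.
Proof.
move=> [[iota [inj_iota src_iota tgt_iota iota_full]] _].
apply/matrixP => i j; rewrite !mxE (inj_eq (@lshift_inj n r)).
congr (_ - _%:Z); rewrite /narrows -(fintype.card_image inj_iota).
apply: eq_card => b; rewrite inE.
apply/andP/fintype.imageP => [[/eqP si /eqP tj]|].
  have [a ba] := iota_full b i j si tj; exists a => //.
  rewrite inE -(inj_eq (@lshift_inj n r)) -src_iota -ba si eqxx.
  by rewrite -(inj_eq (@lshift_inj n r)) -tgt_iota -ba tj eqxx.
by move=> [a /andP[/eqP <- /eqP <-] ->]; rewrite src_iota tgt_iota.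
Qed.

Lemma bmx_extended (n r : nat) (Q : quiver n) (Qt : quiver (n + r)) :
  extended_quiver Q Qt ->
  lsubmx (bmx_ext Qt) = euler Q - (euler Q)^T.
Proof.
move=> /euler_extended <-; apply/matrixP => i j; rewrite !mxE eq_sym.
by rewrite opprB addrC addrA subrK.
Qed.

(** Compatibility turns the matrix of phi followed by L into minus the
    projection to the first n coordinates. *)
Lemma bform_phivec (n r : nat) (Qt : quiver (n + r)) (L : 'M[int]_(n + r)) c y :
  unitally_compatible Qt L ->
  bform L (phivec Qt c) y = - (c *m (lsubmx y)^T) 0 0.
Proof.
rewrite /unitally_compatible => /(congr1 -%R); rewrite opprK => comp.
rewrite /bform /phivec -(mulmxA c) comp opp_row_mx oppr0 mul_mx_row.
rewrite mulmxN mulmx1 mulmx0 -{1}[y]hsubmxK tr_row_mx mul_row_col mul0mx addr0.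
by rewrite mulNmx mxE.
Qed.

Lemma bform_phivec_gvec (n r : nat) (Q : quiver n) (Qt : quiver (n + r))
    (L : 'M[int]_(n + r)) c a :
  extended_quiver Q Qt -> unitally_compatible Qt L ->
  bform L (phivec Qt c) (gvec Qt a) = bform (euler Q) c a.
Proof.
move=> ext comp; rewrite bform_phivec // /bform /gvec -(euler_extended ext).
have -> : lsubmx (- (a *m (euler_ext Qt)^T)) = - (a *m (ulsubmx (euler Qt))^T).
  apply/rowP => j; rewrite !mxE; congr (- _); apply: eq_bigr => i _.
  by rewrite !mxE.
by rewrite linearN /= mulmxN mxE opprK trmx_mul trmxK mulmxA.
Qed.

Lemma bform_phivec_phivec (n r : nat) (Q : quiver n) (Qt : quiver (n + r))
    (L : 'M[int]_(n + r)) c c' :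
  extended_quiver Q Qt -> unitally_compatible Qt L ->
  bform L (phivec Qt c) (phivec Qt c') =
  bform (euler Q) c c' - bform (euler Q) c' c.
Proof.
move=> ext comp; rewrite bform_phivec // /phivec -{1}[bmx_ext Qt]hsubmxK.
rewrite mul_mx_row row_mxKl (bmx_extended ext) trmx_mul.
rewrite -(bform_tr _ c c') /bform linearB /= trmxK mulmxA mulmxBr mulmxBl !mxE.
by rewrite opprB addrC.
Qed.

(** Twice the logarithms in base q: the left side collects the normalizations of
    X(U), X(V) and of the product of the two monomials; on the right the middle
    term, coming from the count of subrepresentations, occurs twice because q
    is the square of q^(1/2). *)
Lemma exponents_match (n r : nat) (Q : quiver n) (Qt : quiver (n + r))
    (L : 'M[int]_(n + r)) (a1 a2 c1 c2 : 'rV[int]_n) :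
  extended_quiver Q Qt -> L^T = - L -> unitally_compatible Qt L ->
  - bform (euler Q) c1 (a1 - c1) - bform (euler Q) c2 (a2 - c2)
    - bform L (gvec Qt a1 - phivec Qt c1) (gvec Qt a2 - phivec Qt c2)
  = - bform L (gvec Qt a1) (gvec Qt a2) + 2%:Z * bform (euler Q) c1 (a2 - c2)
    - bform (euler Q) (c1 + c2) (a2 + a1 - (c1 + c2)).
Proof.
move=> ext Lanti comp.
have LN x y : bform L x y = - bform L y x.
  by rewrite -[LHS]bform_tr Lanti /bform mulmxN mulNmx mxE.
have f1 := bform_phivec_gvec c1 a2 ext comp.
have f2 := bform_phivec_gvec c2 a1 ext comp.
have f12 := bform_phivec_phivec c1 c2 ext comp.
move: (gvec Qt a1) (gvec Qt a2) (phivec Qt c1) (phivec Qt c2) f1 f2 f12.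
move=> g1 g2 p1 p2 f1 f2 f12.
rewrite !(bformDl, bformDr, bformNl, bformNr) (LN g1 p2) f1 f2 f12.
ring.
Qed.

Lemma gvecD (n r : nat) (Qt : quiver (n + r)) a b :
  gvec Qt (a + b) = gvec Qt a + gvec Qt b.
Proof. by rewrite /gvec mulmxDl opprD. Qed.

Lemma phivecD (n r : nat) (Qt : quiver (n + r)) a b :
  phivec Qt (a + b) = phivec Qt a + phivec Qt b.
Proof. exact: mulmxDl. Qed.

Lemma dimvecD (n : nat) (d e : {ffun 'I_n -> nat}) :
  dimvec [ffun i => (d i + e i)%N] = dimvec d + dimvec e.
Proof. by apply/rowP => i; rewrite !mxE ffunE PoszD. Qed.

Lemma expfz_prod3 (C : fieldType) (s : C) (e1 e2 e3 f1 f2 f3 : int) :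
  s != 0 -> e1 + e2 + e3 = f1 + f2 + f3 ->
  s ^ e1 * s ^ e2 * s ^ e3 = s ^ f1 * s ^ f2 * s ^ f3.
Proof. by move=> s0 ef; rewrite -!expfzDr // ef. Qed.

(** * The multiplication formula *)

(** With qchar expanded over subrepresentations and the average over the cocycles
    counted, both sides are sums over the pairs of a subrepresentation of U and
    one of V, and are equal term by term. *)
Lemma qchar_mul (C : numFieldType) (n r : nat) (Q : quiver n)
    (Qt : quiver (n + r)) (F : finFieldType) (s : C)
    (L : 'M[int]_(n + r)) (U V : rep Q F) :
  extended_quiver Q Qt ->
  L^T = - L ->
  unitally_compatible Qt L ->
  s ^+ 2 = #|F|%:R ->
  qmul s L (qchar s Qt U) (qchar s Qt V) =
    s ^ (- bform L (gvec Qt (dimvec (rdim U))) (gvec Qt (dimvec (rdim V)))) *: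
    \sum_(W \in [set: isoclass Q F])
      ((ncard (Ext_with_middle U V (repr W)))%:R / (ncard [set: Ext U V])%:R) *:
      qchar s Qt (repr W).
Proof.
move=> ext Lanti comp sq.
have s0 : s != 0.
  have : s ^+ 2 != 0 by rewrite sq pnatr_eq0 -lt0n; apply/card_gt0P; exists 0.
  by rewrite expf_eq0.
rewrite sum_isoclass; last by move=> M M'; apply: qchar_iso.
rewrite (eq_bigr (fun xi : cocycle U V =>
  \sum_(N : subfam (mid xi) | stable N)
    qchar_term s Q Qt (mid_dim U V) (sdim N))) => [|xi _]; last exact: qcharE.
rewrite sum_mid_stable !qcharE /qchar_term qmul_sum scaler_sumr.
apply: eq_bigr => NU _; rewrite scaler_sumr; apply: eq_bigr => NV _.
have -> : dimvec (mid_dim U V) = dimvec (rdim V) + dimvec (rdim U).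
  exact: dimvecD.
rewrite dimvecD gvecD phivecD !scalerA -sq exprnP exprz_exp.
have -> a b c d : a - c + (b - d) = b + a - (c + d) :> 'rV[int]_(n + r).
  by rewrite addrACA -opprD (addrC a).
have exps := exponents_match (dimvec (rdim U)) (dimvec (rdim V))
  (dimvec (sdim NU)) (dimvec (sdim NV)) ext Lanti comp.
by apply: (congr1 (fun c => c *: _)); apply: expfz_prod3.
Qed.

Theorem proposition5p3 (R : realType) (n r : nat) (Q : quiver n)
    (Qt : quiver (n + r)) (F : finFieldType) (s : R[i])
    (L : 'M[int]_(n + r)) (U V : rep Q F) :
  acyclic Q ->
  extended_quiver Q Qt ->
  L^T = - L ->
  unitally_compatible Qt L ->
  s ^+ 2 = #|F|%:R ->
  qmul s L (qchar s Qt U) (qchar s Qt V) =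
    s ^ (- bform L (gvec Qt (dimvec (rdim U))) (gvec Qt (dimvec (rdim V)))) *:
    \sum_(W \in [set: isoclass Q F])
      ((ncard (Ext_with_middle U V (repr W)))%:R / (ncard [set: Ext U V])%:R) *:
      qchar s Qt (repr W).
Proof. by move=> _; apply: qchar_mul. Qed.
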